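(* Let $R/I$ be a $2$-dimensional standard graded ring with Noether normalization $A=K[x_{n-1},x_n]$, such that $x_n$ is a nonzero divisor on $R/I$. Then the Castelnuovo–Mumford regularity of $R/I$ is $$\mathrm{reg}(R/I)=\max\{\deg(v),\ \deg(u)+\delta_u-1\mid v\in\mathcal B_0,\ u\in\mathcal B_1\}.$$
   Context: $K$ is an infinite field, $R=K[x_1,\dots,x_n]$ with the standard grading $\deg(x_i)=1$, and $I\subset R$ is a homogeneous ideal. That $A$ is a Noether normalization of $R/I$ means that $A\hookrightarrow R/I$ is an integral ring extension. $\mathrm{in}(\cdot)$ denotes the initial ideal with respect to the degree reverse lexicographic order: $x^\alpha>x^\beta$ iff $\deg(x^\alpha)>\deg(x^\beta)$, or the degrees are equal and the last nonzero entry of $\alpha-\beta$ is negative. $\mathcal B_0$ is the (finite) set of monomials of $R$ not belonging to $\mathrm{in}(I+(x_{n-1},x_n))$. $\chi:R\to R$ is the evaluation morphism with $x_i\mapsto x_i$ for $i\le n-2$ and $x_{n-1},x_n\mapsto1$; $J:=\chi(\mathrm{in}(I))\cdot R$; $\mathcal B_1:=\mathcal B_0\cap J$. For $u\in\mathcal B_1$, $\delta_u:=\min\{\delta\mid u\,x_{n-1}^\delta\in\mathrm{in}(I)\}$. *)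

(* Defs.v *)
(* Ideals of R = K[x_1,...,x_n] are Prop-valued predicates; statements about
   R/I are written with representatives in R, modulo I. *)
From HB Require Import structures.
From mathcomp Require Import all_boot all_order all_algebra.
From mathcomp.multinomials Require Export mpoly.

Set Implicit Arguments.
Unset Strict Implicit.
Unset Printing Implicit Defensive.

Import GRing.Theory.
Local Open Scope ring_scope.

Definition infinite_type (T : eqType) : Prop :=
  forall s : seq T, exists x : T, x \notin s.

Section Ideals.
Variables (K : fieldType) (n : nat).
Local Notation R := {mpoly K[n]}.
Implicit Types I J P S : R -> Prop.

Definition is_ideal I : Prop :=
  [/\ I 0, forall f g, I f -> I g -> I (f + g) & forall a f, I f -> I (a * f)].

Definition ideal_gen S : R -> Prop := fun f =>
  exists s : seq (R * R),
    (forall q, q \in s -> S q.2) /\ f = \sum_(q <- s) q.1 * q.2.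

Definition ideal_sum I J : R -> Prop := fun f =>
  exists g h, [/\ I g, J h & f = g + h].

Definition is_homog_ideal I : Prop :=
  is_ideal I /\ forall f d, I f -> I (pihomog mdeg d f).

Definition is_prime_ideal P : Prop :=
  [/\ is_ideal P, ~ P 1 & forall f g, P (f * g) -> P f \/ P g].

(* A strictly increasing chain P_0 < ... < P_d of primes of R containing I,
   i.e. a chain of primes of R/I of length d; only c 0, ..., c d matter. *)
Definition prime_chain I (d : nat) (c : nat -> R -> Prop) : Prop :=
  (forall i, (i <= d)%N -> is_prime_ideal (c i) /\ forall f, I f -> c i f) /\
  (forall i, (i < d)%N ->
     (forall f, c i f -> c i.+1 f) /\ exists f, c i.+1 f /\ ~ c i f).

Definition quotient_dim I (d : nat) : Prop :=
  (exists c, prime_chain I d c) /\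
  forall e c, prime_chain I e c -> (e <= d)%N.

Definition nonzerodivisor_mod I (x : R) : Prop := forall f, I (x * f) -> I f.

(* The K-algebra morphism phi : K[y_1,...,y_k] -> R/I, y_i |-> t_i, is injective
   and R/I is integral over its image. *)
Definition noether_normalization I (k : nat) (t : k.-tuple R) : Prop :=
  (forall a : {mpoly K[k]}, I (comp_mpoly t a) -> a = 0) /\
  (forall f : R, exists2 p : {poly {mpoly K[k]}},
     p \is monic & I (map_poly (comp_mpoly t) p).[f]).

(* x^b < x^a in the degree reverse lexicographic order.  The order `<=%O` that
   multinomials puts on 'X_{1..n} breaks ties lexicographically instead. *)
Definition drl_lt (b a : 'X_{1..n}) : bool :=
  (mdeg b < mdeg a)%N ||
  (mdeg b == mdeg a) &&
  [exists i : 'I_n, (a i < b i)%N &&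
     [forall j : 'I_n, (i < j)%N ==> (a j == b j)]].

Definition is_lead_monomial (f : R) (m : 'X_{1..n}) : Prop :=
  m \in msupp f /\ forall m', m' \in msupp f -> m' != m -> drl_lt m' m.

Definition initial_ideal I : R -> Prop :=
  ideal_gen (fun g => exists f m,
    [/\ I f, is_lead_monomial f m & g = 'X_[m]]).

(* F : ... -> F_2 -> F_1 -> F_0 -> R/I -> 0 is a minimal graded free resolution,
   where F_i = (+)_(k < b i) R(- s i k), elements of F_i are row vectors, the
   differential F_(i+1) -> F_i is v |-> v *m D i, and the augmentation
   F_0 -> R/I is v |-> v *m e modulo I.  The last clause is minimality:
   im(F_(i+1) -> F_i) lies in (x_1,...,x_n) F_i.  No bound on the
   length is imposed; the ranks b i may be 0. *)
Definition minimal_graded_free_resolution I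
    (b : nat -> nat) (s : forall i, 'I_(b i) -> nat)
    (D : forall i, 'M[R]_(b i.+1, b i)) (e : 'cV[R]_(b 0)) : Prop :=
  [/\ (forall k m, m \in msupp (e k 0) -> mdeg m = s 0 k) /\
      (forall i k l m, m \in msupp (D i k l) -> (mdeg m + s i l)%N = s i.+1 k),
      (forall f : R, exists v : 'rV[R]_(b 0), I (f - (v *m e) 0 0)) /\
      (forall v : 'rV[R]_(b 0), I ((v *m e) 0 0) <-> exists w, v = w *m D 0),
      forall i (v : 'rV[R]_(b i.+1)), v *m D i = 0 <-> exists w, v = w *m D i.+1
    & forall i k l, (D i k l)@_0%MM = 0].

(* reg(R/I) = r, i.e. r = max {j - i | beta_(i,j)(R/I) <> 0} where the graded
   Betti number beta_(i,j) counts the summands R(-j) of F_i. The shifts of a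
   minimal resolution of R/I satisfy j >= i, so r is a natural number as soon
   as I <> R. *)
Definition has_CM_regularity I (r : nat) : Prop :=
  exists b s D e,
    [/\ @minimal_graded_free_resolution I b s D e,
        forall i k, (s i k <= r + i)%N
      & exists i k, s i k = (r + i)%N].

End Ideals.

Definition is_max (S : nat -> Prop) (r : nat) : Prop :=
  S r /\ forall q, S q -> (q <= r)%N.

(* R = K[x_1,...,x_N] with N = n + 2, so that xpen = x_(N-1) and xlast = x_N. *)
Section LastTwoVariables.
Variables (K : fieldType) (n : nat).
Local Notation R := {mpoly K[n.+2]}.
Implicit Types I : R -> Prop.

Definition xpen : R := 'X_(inord n).
Definition xlast : R := 'X_ord_max.

Definition B0 I (u : 'X_{1..n.+2}) : Prop :=
  ~ initial_ideal
      (ideal_sum I (ideal_gen (fun g => g = xpen \/ g = xlast))) 'X_[u].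

Definition chi (f : R) : R :=
  comp_mpoly [tuple (if (i < n)%N then 'X_i else 1) | i < n.+2] f.

Definition Jideal I : R -> Prop :=
  ideal_gen (fun g => exists2 f, initial_ideal I f & g = chi f).

Definition B1 I (u : 'X_{1..n.+2}) : Prop := B0 I u /\ Jideal I 'X_[u].

(* delta_u = d; such a d exists for u in B1 when xlast is a nonzero divisor
   on R/I. *)
Definition is_delta I (u : 'X_{1..n.+2}) (d : nat) : Prop :=
  initial_ideal I ('X_[u] * xpen ^+ d) /\
  forall d', initial_ideal I ('X_[u] * xpen ^+ d') -> (d <= d')%N.

(* {deg v, deg u + delta_u - 1 | v in B0, u in B1}; the subtraction is exact,
   as delta_u > 0. *)
Definition regularity_candidates I (q : nat) : Prop :=
  (exists2 v, B0 I v & q = mdeg v) \/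
  (exists u d, [/\ B1 I u, is_delta I u d & q = (mdeg u + d - 1)%N]).

End LastTwoVariables.

(* Main.v *)
(** The regularity of R/I is read off the graded Betti numbers, and these are compared
    with the homology of F / Q_k F, where F is a minimal graded free resolution and
    Q_k is the ideal of the last k variables.  For k = N (all variables) minimality
    makes the differential vanish, so the homology in position i has a class of
    degree j iff j is a shift of F_i.  The long exact sequence of multiplication by
    one more variable shows that the maximum of j - i over the nonzero H_i(F / Q_k F)_j
    is independent of k >= 2.  (A nonzero class in the extremal degree is killed by the
    next variable, hence reappears one step up in position and degree.)

    For k = 2, since x_N is regular on R/I, the only homology is
    H_0 = R/(I + (x_(N-1), x_N)), whose degrees are those of the monomials of B0, and
    H_1 = (0 : x_(N-1)) in R/(I + (x_N)), shifted by one.  The reverse lexicographic order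
    identifies the degrees of the latter with deg u + delta_u - 1 for u in B1.
    Integrality over K[x_(N-1), x_N] makes B0, hence the set of candidates, finite. *)
Require Import Defs.
From Stdlib Require Import Classical IndefiniteDescription.
From mathcomp Require Import all_boot all_order all_algebra zify ring.

Set Implicit Arguments.
Unset Strict Implicit.
Unset Printing Implicit Defensive.

Import Order.TTheory GRing.Theory.
Local Open Scope ring_scope.

(** * Noetherianity and minimal homogeneous generators *)

Lemma seq_choice (S T : eqType) (s : seq S) (Q : S -> T -> Prop) :
  (forall x, x \in s -> exists y, Q x y) ->
  exists t : seq T, (forall y, y \in t -> exists2 x, x \in s & Q x y) /\
                    (forall x, x \in s -> exists2 y, y \in t & Q x y).
Proof.
elim: s => [|x s IH] h; first by exists [::].
have [y Qxy] := h x (mem_head _ _).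
have [|t [t1 t2]] := IH; first by move=> z zs; apply: h; rewrite inE zs orbT.
exists (y :: t); split=> z; rewrite inE => /predU1P[->|zin].
- by exists x; rewrite ?mem_head.
- by have [w ws Qw] := t1 z zin; exists w; rewrite // inE ws orbT.
- by exists y; rewrite ?mem_head.
- by have [w ws Qw] := t2 z zin; exists w; rewrite // inE ws orbT.
Qed.

Lemma nat_minimum (P : nat -> Prop) :
  (exists k, P k) -> exists2 k, P k & forall j, P j -> (k <= j)%N.
Proof.
case=> k; elim/ltn_ind: k => k IH Pk.
case: (classic (exists2 j, P j & (j < k)%N)) => [[j Pj jk]|h]; first exact: IH jk Pj.
by exists k => // j Pj; rewrite leqNgt; apply/negP => jk; apply: h; exists j.
Qed.

(** Induction on the number [k] of coordinates that are compared. A finite set [s] that works for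
    the first [k] coordinates still works for one more on every [m] whose next coordinate is at
    least the maximum over [s]. Each of the finitely many smaller values gives a slice, which gets
    its own finite set. *)
Lemma dickson n (P : 'X_{1..n} -> Prop) :
  exists s : seq 'X_{1..n}, (forall m, m \in s -> P m) /\
    forall m, P m -> exists2 m', m' \in s & (m' <= m)%MM.
Proof.
suff /(_ n P) [s [sP hs]] : forall k (P : 'X_{1..n} -> Prop),
    exists s : seq 'X_{1..n}, (forall m, m \in s -> P m) /\
    forall m, P m -> exists2 m', m' \in s & forall i : 'I_n, (i < k)%N -> (m' i <= m i)%N.
  exists s; split=> // m /hs [m' m's h]; exists m' => //.
  by apply/mnm_lepP => i; apply: h.
elim=> [|k IH] {}P.
  case: (classic (exists m, P m)) => [[m Pm]|nP].
    by exists [:: m]; split=> [m'|m' _]; [rewrite inE => /eqP-> | exists m; rewrite ?mem_head].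
  by exists [::]; split=> // m Pm; case: nP; exists m.
case: (ltnP k n) => [kn|nk]; last first.
  have [s [sP hs]] := IH P; exists s; split=> // m /hs [m' m's h].
  by exists m' => // i _; apply: h; apply: leq_trans (ltn_ord i) nk.
pose i0 := Ordinal kn.
have [s [sP hs]] := IH P.
have [t [tP ht]] : exists t : seq 'X_{1..n}, (forall m, m \in t -> P m) /\
    forall m, P m -> (m i0 < \max_(m' <- s) m' i0)%N ->
      exists2 m', m' \in t & forall i : 'I_n, (i < k.+1)%N -> (m' i <= m i)%N.
  elim: (\max_(m' <- s) _)%N => [|c [t [tP ht]]]; first by exists [::].
  have [t' [t'P ht']] := IH (fun m => P m /\ m i0 = c).
  exists (t ++ t'); split=> [m|m Pm]; first by rewrite mem_cat => /orP[/tP//|/t'P[]].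
  rewrite ltnS leq_eqVlt => /predU1P[mc|/(ht m Pm)[m' m't h]]; last first.
    by exists m' => //; rewrite mem_cat m't.
  have [m' m't h] := ht' m (conj Pm mc); exists m'; first by rewrite mem_cat m't orbT.
  move=> i; rewrite ltnS leq_eqVlt => /predU1P[ik|]; last exact: h.
  have -> : i = i0 by apply: val_inj.
  by rewrite mc; have [_ ->] := t'P m' m't.
exists (s ++ t); split=> [m|m Pm]; first by rewrite mem_cat => /orP[/sP|/tP].
have [mlt|mge] := ltnP (m i0) (\max_(m' <- s) m' i0)%N.
  by have [m' m't h] := ht m Pm mlt; exists m'; rewrite // mem_cat m't orbT.
have [m' m's h] := hs m Pm; exists m'; first by rewrite mem_cat m's.
move=> i; rewrite ltnS leq_eqVlt => /predU1P[ik|]; last exact: h.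
have -> : i = i0 by apply: val_inj.
by apply: leq_trans mge; rewrite (leq_bigmax_seq m').
Qed.

(** * Graded submodules of free modules over a polynomial ring *)

Section Graded.
Variables (K : fieldType) (n : nat).
Local Notation R := {mpoly K[n]}.

Definition submodule (b : nat) (Z : 'rV[R]_b -> Prop) : Prop :=
  [/\ Z 0, forall u v, Z u -> Z v -> Z (u + v) & forall a v, Z v -> Z (a *: v)].

Lemma submoduleB b (Z : 'rV[R]_b -> Prop) u v :
  submodule Z -> Z u -> Z v -> Z (u - v).
Proof. by case=> _ ZD ZZ Zu Zv; rewrite -scaleN1r; apply: ZD => //; apply: ZZ. Qed.

(** One step of division, for the well-founded order [<=%O]. It serves Noetherianity, where any such
    monomial order does; the degree reverse lexicographic order enters only with initial ideals. *)
Lemma mlead_cancel (p q : R) (m : 'X_{1..n}) :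
  p != 0 -> q != 0 -> mlead p = (m + mlead q)%MM ->
  p - (mleadc p / mleadc q) *: 'X_[m] * q = 0 \/
  (mlead (p - (mleadc p / mleadc q) *: 'X_[m] * q) < mlead p)%O.
Proof.
move=> p0 q0 e; set c := _ / _; set f := p - _.
have [->|f0] := eqVneq f 0; [by left | right].
have c0 : c != 0 by rewrite mulf_neq0 ?invr_eq0 ?mleadc_eq0.
have X0 : c *: 'X_[m] != 0 :> R.
  by rewrite scaler_eq0 negb_or c0 /= -msupp_eq0 msuppX.
have lX : mlead (c *: 'X_[m] : R) = m.
  by rewrite mleadZ_proper ?mleadXm // mcoeffX eqxx mulr1.
have lq : mlead (c *: 'X_[m] * q) = mlead p by rewrite mleadM // lX e.
rewrite lt_neqAle; apply/andP; split; last first.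
  by apply: le_trans (mleadB_le _ _) _; rewrite lq joinxx.
apply/eqP => lf; move: (mleadc_eq0 f); rewrite (negbTE f0) lf /f mcoeffB.
rewrite -scalerAl mcoeffZ.
have -> : ('X_[m] * q)@_(mlead p) = mleadc q.
  by rewrite e ['X_[m] * q]mulrC mcoeffMX.
by rewrite /c divfK ?mleadc_eq0 // subrr eqxx.
Qed.

(* Span membership is expressed by quantifying over the submodules that contain
   the generators. *)
Lemma noetherian b (Z : 'rV[R]_b -> Prop) : submodule Z ->
  exists s : seq 'rV[R]_b, (forall v, v \in s -> Z v) /\
    forall W, submodule W -> (forall v, v \in s -> W v) -> forall v, Z v -> W v.
Proof.
move=> ZS; have [Z0 ZD ZZ] := ZS.
suff /(_ b) [s [sZ hs]] : forall k, exists s : seq 'rV[R]_b,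
    (forall v, v \in s -> Z v) /\
    forall W, submodule W -> (forall v, v \in s -> W v) ->
    forall v, Z v -> (forall l : 'I_b, (k <= l)%N -> v 0 l = 0) -> W v.
  exists s; split=> // W WS sW v Zv; apply: (hs W) => // l.
  by rewrite leqNgt ltn_ord.
elim=> [|k [s [sZ hs]]].
  exists [::]; split=> // W [W0 _ _] _ v _ v0.
  by have -> : v = 0 by apply/rowP => l; rewrite v0 // mxE.
have [bk|kb] := leqP b k.
  exists s; split=> // W WS sW v Zv _; apply: (hs W) => // l kl.
  by have := leq_trans bk kl; rewrite leqNgt ltn_ord.
pose l0 := Ordinal kb.
pose Q (m : 'X_{1..n}) (v : 'rV[R]_b) :=
  [/\ Z v, forall l : 'I_b, (k < l)%N -> v 0 l = 0, v 0 l0 != 0 & mlead (v 0 l0) = m].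
(* Among the elements of [Z] living in the first [k + 1] coordinates, [t] realizes enough leading
   monomials of the last of these to reduce that coordinate to 0, after which [s] takes over. *)
have [ms [msP hms]] := dickson (fun m => exists v, Q m v).
have [t [t1 t2]] := seq_choice msP.
exists (s ++ t); split=> [v|W WS sW]; first by rewrite mem_cat => /orP[/sZ|/t1[m _ []]].
have Ws v : v \in s -> W v by move=> vs; apply: sW; rewrite mem_cat vs.
have Wt v : v \in t -> W v by move=> vt; apply: sW; rewrite mem_cat vt orbT.
suff main m : forall v, Z v -> (forall l : 'I_b, (k < l)%N -> v 0 l = 0) ->
    mlead (v 0 l0) = m -> W v by move=> v Zv hv; apply: (main _ v).
elim/(well_founded_ind (@ltom_wf n)): m => m IH v Zv hv vm.
have low (u : 'rV[R]_b) : Z u -> (forall l : 'I_b, (k < l)%N -> u 0 l = 0) ->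
    u 0 l0 = 0 -> W u.
  move=> Zu hu u0; apply: (hs W) => // l; rewrite leq_eqVlt => /predU1P[kl|/hu//].
  by have -> : l = l0 by apply: val_inj.
have [v0|v0] := eqVneq (v 0 l0) 0; first exact: low.
have [m' m's m'm] := hms m (ex_intro _ v (And4 Zv hv v0 vm)).
have [u ut [Zu hu u0 um]] := t2 m' m's.
pose a : R := (mleadc (v 0 l0) / mleadc (u 0 l0)) *: 'X_[m - m'].
have Zvu : Z (v - a *: u) by apply: submoduleB => //; apply: ZZ.
have hvu (l : 'I_b) : (k < l)%N -> (v - a *: u) 0 l = 0.
  by move=> kl; rewrite !mxE hv // hu // mulr0 subr0.
have Wvu : W (v - a *: u).
  have := @mlead_cancel (v 0 l0) (u 0 l0) (m - m')%MM v0 u0.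
  have vE : (v - a *: u) 0 l0 = v 0 l0 - a * u 0 l0 by rewrite !mxE.
  rewrite -/a -vE um submK // => /(_ vm) [e|lt]; first exact: low.
  by apply: (IH _ _ (v - a *: u)) => //; rewrite -vm.
have [_ WD WZ] := WS.
by rewrite -[v](subrK (a *: u)); apply: WD => //; apply: WZ; apply: Wt.
Qed.

Lemma mcoeff_pihomog d (p : R) m :
  (pihomog mdeg d p)@_m = if mdeg m == d then p@_m else 0.
Proof.
rewrite pihomogE raddf_sum /=.
transitivity (\sum_(m' <- msupp p | (mdeg m' == d) && (m' == m)) p@_m).
  rewrite [LHS]big_mkcond [RHS]big_mkcond /=; apply: eq_bigr => m' _.
  rewrite mcoeffZ mcoeffX; case: (mdeg m' == d) => //=.
  by have [->|] := eqVneq m' m; rewrite ?mulr1 ?mulr0.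
have [md|md] := eqVneq (mdeg m) d; last first.
  by rewrite big_pred0 // => m'; have [->|] := eqVneq m' m; rewrite ?andbF ?(negbTE md).
have [mp|mp] := boolP (m \in msupp p); last first.
  by rewrite (memN_msupp_eq0 mp) big1.
rewrite (eq_bigl (pred1 m)) => [|m' /=]; last first.
  by have [->|] := eqVneq m' m; rewrite ?andbF ?md ?eqxx.
by rewrite -big_filter filter_pred1_uniq // big_seq1.
Qed.

(** The component of degree [d] of [p], viewed in R(-a). The test is needed because [d - a] is
    truncated: without it the constant term would reappear in all degrees below [a]. *)
Definition hpart (a d : nat) (p : R) : R :=
  if (a <= d)%N then pihomog mdeg (d - a) p else 0.

Lemma mcoeff_hpart a d p m :
  (hpart a d p)@_m = if (mdeg m + a == d)%N then p@_m else 0.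
Proof.
rewrite /hpart; case: leqP => ad; last first.
  by rewrite mcoeff0 ifF //; apply/eqP; lia.
by rewrite mcoeff_pihomog; congr (if _ then _ else _); apply/eqP/eqP; lia.
Qed.

Lemma hpartM a a' d (p q : R) :
  (forall m, m \in msupp q -> (mdeg m + a')%N = a) ->
  hpart a' d (p * q) = hpart a d p * q.
Proof.
move=> hq; apply/mpolyP => m; rewrite mcoeff_hpart !mcoeffM.
under [RHS]eq_bigr do rewrite mcoeff_hpart.
case: eqP => md; last rewrite big1 //; last first.
- move=> k /eqP e; case: eqP => kd; last by rewrite mul0r.
  have [kq|kq] := boolP ((k.2 : 'X_{1..n}) \in msupp q); last first.
    by rewrite (memN_msupp_eq0 kq) mulr0.
  by case: md; rewrite e mdegD -addnA (hq _ kq).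
- apply: eq_bigr => k /eqP e.
  have [kq|kq] := boolP ((k.2 : 'X_{1..n}) \in msupp q); last first.
    by rewrite (memN_msupp_eq0 kq) !mulr0.
  have := congr1 mdeg e; rewrite mdegD => e'.
  by rewrite ifT // -(hq _ kq) addnA -e' md.
Qed.

Lemma hpartD a d : {morph hpart a d : p q / p + q}.
Proof.
move=> p q; apply/mpolyP => m; rewrite mcoeffD !mcoeff_hpart mcoeffD.
by case: ifP; rewrite ?addr0.
Qed.

Lemma hpart0 a d : hpart a d 0 = 0.
Proof. by apply/mpolyP => m; rewrite mcoeff_hpart mcoeff0 if_same. Qed.

Lemma hpart_sum a d (T : Type) (r : seq T) (F : T -> R) :
  hpart a d (\sum_(i <- r) F i) = \sum_(i <- r) hpart a d (F i).
Proof. by apply: (big_morph _ (hpartD a d) (hpart0 a d)). Qed.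

Definition gpart b (s : 'I_b -> nat) (d : nat) (v : 'rV[R]_b) : 'rV[R]_b :=
  \row_l hpart (s l) d (v 0 l).

(* v is homogeneous of degree d in the direct sum of the R(- s l). *)
Definition homogeneous b (s : 'I_b -> nat) (d : nat) (v : 'rV[R]_b) : Prop :=
  forall l m, m \in msupp (v 0 l) -> (mdeg m + s l)%N = d.

Definition homogeneous_mx b b' (s : 'I_b -> nat) (s' : 'I_b' -> nat) (D : 'M[R]_(b', b)) :=
  forall k, homogeneous s (s' k) (row k D).

Lemma gpart_homog b (s : 'I_b -> nat) d v : homogeneous s d (gpart s d v).
Proof.
move=> l m; rewrite mxE mcoeff_msupp mcoeff_hpart.
by have [|_] := eqVneq (mdeg m + s l)%N d; rewrite ?eqxx.
Qed.

Lemma gpart_id b (s : 'I_b -> nat) d v : homogeneous s d v -> gpart s d v = v.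
Proof.
move=> hv; apply/rowP => l; rewrite mxE; apply/mpolyP => m; rewrite mcoeff_hpart.
have [mv|mv] := boolP (m \in msupp (v 0 l)); first by rewrite (hv l m mv) eqxx.
by rewrite (memN_msupp_eq0 mv) if_same.
Qed.

Lemma gpartD b (s : 'I_b -> nat) d : {morph gpart s d : u v / u + v}.
Proof. by move=> u v; apply/rowP => l; rewrite !mxE hpartD. Qed.

Lemma gpart_mul b b' (s : 'I_b -> nat) (s' : 'I_b' -> nat) (D : 'M[R]_(b', b)) d w :
  homogeneous_mx s s' D -> gpart s d (w *m D) = gpart s' d w *m D.
Proof.
move=> hD; apply/rowP => l; rewrite !mxE hpart_sum; apply: eq_bigr => k _.
by rewrite mxE (@hpartM (s' k)) // => m mD; apply: (hD k); rewrite mxE.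
Qed.

Lemma homogeneous_mul b b' (s : 'I_b -> nat) (s' : 'I_b' -> nat) (D : 'M[R]_(b', b)) d w :
  homogeneous_mx s s' D -> homogeneous s' d w -> homogeneous s d (w *m D).
Proof. by move=> hD hw; rewrite -(gpart_id hw) -(gpart_mul _ _ hD); apply: gpart_homog. Qed.

Lemma homogeneousB b (s : 'I_b -> nat) d u v :
  homogeneous s d u -> homogeneous s d v -> homogeneous s d (u - v).
Proof.
move=> hu hv l m; rewrite !mxE => /msuppB_le; rewrite mem_cat.
by move=> /orP[/hu|/hv].
Qed.

Lemma homogeneousX b (s : 'I_b -> nat) d v m :
  homogeneous s d v -> homogeneous s (mdeg m + d) ('X_[m] *: v).
Proof.
move=> hv l m'; rewrite mxE mulrC (perm_mem (msuppMX _ _)) => /mapP[m1 m1v ->].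
by rewrite mdegD -addnA (hv _ _ m1v).
Qed.

Definition graded_submodule b (s : 'I_b -> nat) (Z : 'rV[R]_b -> Prop) :=
  submodule Z /\ forall d v, Z v -> Z (gpart s d v).

Lemma gpart_decomp b (s : 'I_b -> nat) v :
  exists d, v = \sum_(i < d) gpart s i v.
Proof.
pose B := (\max_(l < b) \max_(m <- msupp (v 0%R l)) (mdeg m + s l).+1)%N.
exists B; apply/rowP => l; rewrite summxE; apply/mpolyP => m; rewrite raddf_sum /=.
under eq_bigr do rewrite mxE mcoeff_hpart.
have [mv|mv] := boolP (m \in msupp (v 0 l)); last first.
  by rewrite (memN_msupp_eq0 mv) big1 // => i _; rewrite if_same.
have mB : (mdeg m + s l < B)%N.
  apply: leq_trans (leq_bigmax l).
  exact: (@leq_bigmax_seq _ _ predT (fun m => (mdeg m + s l).+1) m).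
rewrite (bigD1 (Ordinal mB)) //= eqxx big1 ?addr0 // => i.
by rewrite -val_eqE /= eq_sym => /negbTE->.
Qed.

Lemma submodule_sum b (Z : 'rV[R]_b -> Prop) (T : eqType) (r : seq T) (F : T -> 'rV[R]_b) :
  submodule Z -> (forall i, i \in r -> Z (F i)) -> Z (\sum_(i <- r) F i).
Proof.
case=> Z0 ZD _ h; rewrite big_seq_cond; elim/big_rec: _ => // i x.
by rewrite andbT => ir; apply: ZD; apply: h.
Qed.

Lemma row_span b b' (D : 'M[R]_(b', b)) (Z : 'rV[R]_b -> Prop) w :
  submodule Z -> (forall k, Z (row k D)) -> Z (w *m D).
Proof.
move=> ZS h; rewrite mulmx_sum_row; apply: submodule_sum => // k _.
by have [_ _ ZZ] := ZS; apply: ZZ.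
Qed.

Definition generates b (s : 'I_b -> nat) (Z : 'rV[R]_b -> Prop)
    b' (s' : 'I_b' -> nat) (D : 'M[R]_(b', b)) :=
  homogeneous_mx s s' D /\ forall v, Z v <-> exists w, v = w *m D.

(** The homogeneous components of a finite generating set stay in [Z] and generate it; each is
    recorded together with its degree, which becomes its shift. *)
Lemma graded_fg b (s : 'I_b -> nat) Z : graded_submodule s Z ->
  exists b' s' (D : 'M[R]_(b', b)), generates s Z s' D.
Proof.
move=> [ZS Zg]; have [t [tZ ht]] := noetherian ZS.
have [t' [t'1 t'2]] : exists t' : seq (nat * 'rV[R]_b),
    (forall q, q \in t' -> homogeneous s q.1 q.2 /\ Z q.2) /\
    (forall W, submodule W -> (forall q, q \in t' -> W q.2) -> forall v, v \in t -> W v).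
  elim: t tZ {ht} => [|v t IH] tZ; first by exists [::].
  have [|t' [t'1 t'2]] := IH; first by move=> z zt; apply: tZ; rewrite inE zt orbT.
  have [d vE] := gpart_decomp s v.
  exists ([seq (i, gpart s i v) | i <- iota 0 d] ++ t'); split=> [q|W WS h u].
    rewrite mem_cat => /orP[/mapP[i _ ->]|/t'1//] /=.
    by split; [apply: gpart_homog | apply: Zg; apply: tZ; rewrite mem_head].
  rewrite inE => /predU1P[->|ut]; last first.
    by apply: t'2 ut => // q qt'; apply: h; rewrite mem_cat qt' orbT.
  rewrite vE; apply: submodule_sum => // i _.
  apply: (h (i : nat, gpart s i v)); rewrite mem_cat; apply/orP; left.
  by apply/mapP; exists (i : nat) => //; rewrite mem_iota ltn_ord.
exists (size t'), (fun k => (tnth (in_tuple t') k).1).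
pose D := \matrix_(k < size t') (tnth (in_tuple t') k).2.
have rD k : row k D = (tnth (in_tuple t') k).2 by apply/rowP => l; rewrite !mxE.
exists D; split=> [k|v].
  by rewrite rD; have [] := t'1 _ (mem_tnth k (in_tuple t')).
split=> [Zv|[w ->]]; last first.
  by apply: row_span => // k; rewrite rD; have [] := t'1 _ (mem_tnth k (in_tuple t')).
have WS : submodule (fun v => exists w, v = w *m D).
  split=> [|u1 u2 [w1 ->] [w2 ->]|a u [w ->]]; first by exists 0; rewrite mul0mx.
    by exists (w1 + w2); rewrite mulmxDl.
  by exists (a *: w); rewrite -scalemxAl.
apply: (ht _ WS) Zv; apply: t'2 => // q qt'.
have /tnthP[k ->] : q \in in_tuple t' by [].
by exists (delta_mx 0 k); rewrite -rowE rD.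
Qed.

Lemma msupp_deg0 (p : R) : (forall m, m \in msupp p -> mdeg m = 0%N) -> p = (p@_0)%:MP.
Proof.
move=> h; apply/mpolyP => m; rewrite mcoeffC.
have [->|m0] := eqVneq m 0%MM; first by rewrite mulr1.
rewrite mulr0; apply: memN_msupp_eq0; apply/negP => /h/eqP.
by rewrite mdeg_eq0 (negbTE m0).
Qed.

(* Among homogeneous generating families, one of least cardinality has no syzygy
   with a nonzero constant coefficient. *)
Lemma minimal_generators b (s : 'I_b -> nat) Z : graded_submodule s Z ->
  exists b' s' (D : 'M[R]_(b', b)), generates s Z s' D /\
    forall w : 'rV[R]_b', w *m D = 0 -> forall k, (w 0 k)@_0 = 0.
Proof.
move=> /graded_fg h.
have [b' [s' [D gD]] bmin] := nat_minimum h.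
exists b', s', D; split=> // w wD k.
apply/eqP/negPn/negP => wk.
have [hD hZ] := gD.
case: b' k s' D gD bmin hD hZ w wD wk => [[]//|b'] k s' D gD bmin hD hZ w wD wk.
suff /bmin : exists (s0 : 'I_b' -> nat) (D0 : 'M[R]_(b', b)), generates s Z s0 D0.
  by rewrite ltnn.
(* In this degree the syzygy has the nonzero constant [c] as its entry at [k], so it expresses the
   generator [k] through the others. *)
pose u := gpart s' (s' k) w.
have uD : u *m D = 0.
  by rewrite -(gpart_mul _ _ hD) wD; apply/rowP => l; rewrite !mxE hpart0.
pose c := (w 0 k)@_0.
have uk : u 0 k = c%:MP.
  rewrite [LHS]msupp_deg0 => [|m /gpart_homog]; last lia.
  by rewrite mxE mcoeff_hpart mdeg0 eqxx.
exists (fun l => s' (lift k l)), (row' k D); split=> [l|v].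
  by have := hD (lift k l); congr (homogeneous _ _ _); apply/rowP => j; rewrite !mxE.
rewrite hZ; split=> [[w' ->]|[w' ->]]; last first.
  exists (\row_l if unlift k l is Some j then w' 0 j else 0).
  apply/rowP => l; rewrite !mxE [RHS](bigD1_ord k) //= !mxE unlift_none mul0r add0r.
  by apply: eq_bigr => j _; rewrite !mxE liftK.
pose w'' := w' - (w' 0 k * (c^-1)%:MP) *: u.
have w''k : w'' 0 k = 0.
  by move: uk; rewrite !mxE => ->; rewrite -mulrA -mpolyCM mulVf // mulr1 subrr.
exists (col' k w''); have -> : w' *m D = w'' *m D.
  by rewrite mulmxBl -scalemxAl uD scaler0 subr0.
apply/rowP => l; rewrite !mxE (bigD1_ord k) //= w''k mul0r add0r.
by apply: eq_bigr => j _; rewrite !mxE.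
Qed.

End Graded.

(** * Existence of minimal graded free resolutions *)

Section Resolution.
Variables (K : fieldType) (n : nat).
Local Notation R := {mpoly K[n]}.

(** A stage is a free module F_i with the kernel of the map leaving it. Bundling the rank with the
    kernel lets the construction be iterated although every rank depends on the stage before. *)
Record syzygy_stage := SyzygyStage {
  stage_rank : nat;
  stage_shift : 'I_stage_rank -> nat;
  stage_rel : 'rV[R]_stage_rank -> Prop;
  stage_graded : graded_submodule stage_shift stage_rel;
  stage_minimal : forall v, stage_rel v -> forall l, (v 0 l)@_0 = 0 }.

Definition next_stage (t t' : syzygy_stage)
    (D : 'M[R]_(stage_rank t', stage_rank t)) : Prop :=
  generates (@stage_shift t) (@stage_rel t) (@stage_shift t') D /\
  forall w, stage_rel w <-> w *m D = 0.

Lemma next_stage_exists t : exists t' D, @next_stage t t' D.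
Proof.
have [b [s [D [gD minD]]]] := minimal_generators (stage_graded t).
have gS : graded_submodule s (fun w => w *m D = 0).
  split=> [|d v vD]; last first.
    have [hD _] := gD; rewrite -(gpart_mul _ _ hD) vD.
    by apply/rowP => l; rewrite !mxE hpart0.
  split=> [|u v uD vD|a v vD]; first by rewrite mul0mx.
    by rewrite mulmxDl uD vD addr0.
  by rewrite -scalemxAl vD scaler0.
by exists (SyzygyStage gS minD), D; split.
Qed.

(** A nonzero constant term would be the component of degree 0, a unit lying in [I]. *)
Lemma homog_ideal_constant (I : R -> Prop) :
  is_homog_ideal I -> ~ I 1 -> forall f, I f -> f@_0 = 0.
Proof.
move=> [[I0 ID IM] Ih] I1 f If; apply/eqP/negPn/negP => f0; apply: I1.
have -> : 1 = (f@_0)^-1%:MP * pihomog mdeg 0 f.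
  rewrite [pihomog _ _ _]msupp_deg0 => [|m]; last first.
    by rewrite mcoeff_msupp mcoeff_pihomog; have [|_] := eqVneq (mdeg m) 0%N; rewrite ?eqxx.
  by rewrite mcoeff_pihomog mdeg0 eqxx -mpolyCM mulVf // mpolyC1.
by apply: IM; apply: Ih.
Qed.

(** The construction starts from F_0 = R with [I] as kernel; as [I] is proper, the first
    differential is minimal. A chosen successor of each stage is then iterated. *)
Lemma minimal_resolution_exists (I : R -> Prop) : is_homog_ideal I -> ~ I 1 ->
  exists b s D e, @minimal_graded_free_resolution K n I b s D e.
Proof.
move=> hI I1; have hI0 := homog_ideal_constant hI I1.
have [[I0 ID IM] Ih] := hI.
pose Z (v : 'rV[R]_1) := I (v 0 0).
have gZ : graded_submodule (fun _ => 0%N) Z.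
  split=> [|d v Zv]; last by rewrite /Z mxE /hpart subn0; apply: Ih.
  by split=> [|u v|a v]; rewrite /Z mxE => //; [apply: ID | apply: IM].
have mZ v : Z v -> forall l, (v 0 l)@_0 = 0 by move=> Zv l; rewrite ord1; apply: hI0.
pose t0 := SyzygyStage gZ mZ.
pose next t := proj1_sig (constructive_indefinite_description _ (next_stage_exists t)).
have nextP t : exists D, @next_stage t (next t) D.
  exact: proj2_sig (constructive_indefinite_description _ (next_stage_exists t)).
pose T i := iter i next t0.
pose D i : 'M[R]_(stage_rank (T i.+1), stage_rank (T i)) :=
  proj1_sig (constructive_indefinite_description _ (nextP (T i))).
have DP i : next_stage (D i).
  exact: proj2_sig (constructive_indefinite_description _ (nextP (T i))).
exists (fun i => stage_rank (T i)), (fun i => @stage_shift (T i)), D, (const_mx 1).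
have vE (v : 'rV[R]_(stage_rank (T 0%N))) :
    (v *m (const_mx 1 : 'cV_(stage_rank (T 0%N)))) 0 0 = v 0 0.
  by rewrite mxE (big_ord1 _ (fun i => v 0 i * const_mx 1 i 0)) mxE mulr1.
split.
- split=> [k m|i k l m mD]; first by rewrite mxE msupp1 inE => /eqP->; rewrite mdeg0.
  by have [[hD _] _] := DP i; apply: (hD k); rewrite mxE.
- split=> [f|v]; first by exists (const_mx f); rewrite vE mxE subrr.
  by rewrite vE; have [[_ h] _] := DP 0%N; apply: h.
- move=> i v; have [_ <-] := DP i; have [[_ h] _] := DP i.+1; exact: h.
- move=> i k l; have [[_ h] _] := DP i.
  have := @stage_minimal (T i) (row k (D i)) _ l; rewrite mxE; apply.
  by apply/h; exists (delta_mx 0 k); rewrite -rowE.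
Qed.

End Resolution.

(** * Homology modulo the last variables *)

Section TailIdeal.
Variables (K : fieldType) (n : nat).
Local Notation R := {mpoly K[n]}.
Implicit Types (f g : R) (m : 'X_{1..n}).

Definition tail_free (k : nat) m : bool := [forall i : 'I_n, (n - k <= i)%N ==> (m i == 0%N)].

(* The ideal generated by the last k variables. *)
Definition tail_ideal (k : nat) f : Prop := forall m, tail_free k m -> f@_m = 0.

Lemma tail_freeP k m :
  reflect (forall i : 'I_n, (n - k <= i)%N -> m i = 0%N) (tail_free k m).
Proof.
apply: (iffP forallP) => [h i ki|h i]; first by apply/eqP; move: (h i); rewrite ki.
by apply/implyP => ki; rewrite h.
Qed.

(** Here [rev_ord k] is the variable in position [k + 1] from the end, the one that is added in
    passing from [tail_ideal k] to [tail_ideal k.+1]. *)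
Lemma tail_freeS (k : 'I_n) m :
  tail_free k.+1 m = tail_free k m && (m (rev_ord k) == 0%N).
Proof.
have kn := ltn_ord k.
apply/tail_freeP/andP => [h|[/tail_freeP h /eqP h0] i].
  split; last by apply/eqP/h; rewrite /=; lia.
  by apply/tail_freeP => i ki; apply: h; lia.
rewrite leq_eqVlt => /predU1P[ik|ik]; last by apply: h; lia.
by have -> : i = rev_ord k by apply: val_inj; rewrite /= -ik.
Qed.

Lemma tail_ideal0 k : tail_ideal k 0.
Proof. by move=> m _; rewrite mcoeff0. Qed.

Lemma tail_idealD k f g : tail_ideal k f -> tail_ideal k g -> tail_ideal k (f + g).
Proof. by move=> hf hg m km; rewrite mcoeffD hf ?hg ?addr0. Qed.

Lemma tail_idealM k f g : tail_ideal k f -> tail_ideal k (g * f).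
Proof.
move=> hf m /tail_freeP km; rewrite mcoeffM big1 // => j /eqP e.
rewrite [X in _ * X]hf ?mulr0 //; apply/tail_freeP => i /km.
by rewrite {1}e mnmDE => /eqP; rewrite addn_eq0 => /andP[_ /eqP].
Qed.

Lemma tail_idealB k f g : tail_ideal k f -> tail_ideal k g -> tail_ideal k (f - g).
Proof. by move=> hf hg m km; rewrite mcoeffB hf ?hg ?subr0. Qed.

Lemma tail_ideal_le k k' f : (k <= k')%N -> tail_ideal k f -> tail_ideal k' f.
Proof.
move=> kk' hf m /tail_freeP km; apply: hf; apply/tail_freeP => i ki.
by apply: km; lia.
Qed.

Lemma tail_ideal_eq0 f : tail_ideal 0 f <-> f = 0.
Proof.
split=> [h|->]; last exact: tail_ideal0.
apply/mpolyP => m; rewrite mcoeff0 h //; apply/tail_freeP => i.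
by rewrite subn0 leqNgt ltn_ord.
Qed.

Lemma tail_ideal_full f : tail_ideal n f <-> f@_0 = 0.
Proof.
split=> [h|h m /tail_freeP hm]; first by apply: h; apply/tail_freeP => i _; rewrite mnm0E.
suff -> : m = 0%MM by [].
by apply/mnmP => i; rewrite mnm0E hm ?subnn.
Qed.

Lemma tail_ideal_hpart k a d f : tail_ideal k f -> tail_ideal k (hpart a d f).
Proof. by move=> hf m km; rewrite mcoeff_hpart hf // if_same. Qed.

Lemma tail_idealX (k : 'I_n) f : tail_ideal k.+1 ('X_(rev_ord k) * f).
Proof.
move=> m; rewrite tail_freeS => /andP[_ /eqP mk]; rewrite mcoeffM big1 // => j /eqP e.
rewrite mcoeffX; have [ej|] := eqVneq; last by rewrite mul0r.
by move: mk; rewrite {1}e -ej mnmDE mnm1E eqxx.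
Qed.

(** The quotient by [tail_ideal k] is a polynomial ring in the remaining variables, and [rev_ord k]
    is one of them. *)
Lemma tail_ideal_reg (k : 'I_n) f : tail_ideal k ('X_(rev_ord k) * f) -> tail_ideal k f.
Proof.
move=> h m /tail_freeP km; rewrite -(mcoeffMX f U_(rev_ord k)) mulrC h //.
apply/tail_freeP => i ki; rewrite mnmDE km // mnm1E; case: eqP => // ik.
by move: ki; rewrite -ik /=; have := ltn_ord k; lia.
Qed.

(** The quotient [g] uses only the terms of [f] free of the last [k] variables, all of which are
    divisible by the new one. The control on its support later transports homogeneity and leading
    monomials. *)
Lemma tail_ideal_div (k : 'I_n) f : tail_ideal k.+1 f ->
  exists2 g, tail_ideal k (f - 'X_(rev_ord k) * g) &
    forall m, m \in msupp g -> (m + U_(rev_ord k))%MM \in msupp f.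
Proof.
set e := U_(rev_ord k)%MM => hf.
pose g := \sum_(m <- msupp f | tail_free k m) f@_m *: 'X_[m - e] : R.
have ge m : m \in msupp f -> tail_free k m -> (m - e + e)%MM = m.
  move=> mf km; apply: submK; rewrite lep1mP; apply/eqP => mk.
  by move: mf; rewrite mcoeff_msupp hf ?eqxx // tail_freeS km mk eqxx.
have Xg : 'X_[e] * g = \sum_(m <- msupp f | tail_free k m) f@_m *: 'X_[m].
  rewrite mulr_sumr big_seq_cond [RHS]big_seq_cond; apply: eq_bigr => m /andP[mf km].
  by rewrite -scalerAr -mpolyXD addmC ge.
exists g => [m km|m].
  rewrite mcoeffB Xg {1}[f]mpolyE !raddf_sum /=.
  rewrite [X in _ + X]big_mkcond -big_split /= big1 // => m' _.
  have [m'm|m'm] := eqVneq m' m; first by rewrite m'm km subrr.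
  by case: ifP => _; rewrite mcoeffZ mcoeffX (negbTE m'm) mulr0 ?oppr0 addr0.
move=> mg; move: (msupp_sum_le mg) => /flatten_mapP[m'].
rewrite mem_filter => /andP[km' m'f] /msuppZ_le /mem_msuppXP <-.
by rewrite ge.
Qed.

End TailIdeal.

(** * Homology of the resolution modulo one more variable *)

Section Descent.
Variables (K : fieldType) (n : nat).
Local Notation R := {mpoly K[n]}.
Variables (b : nat -> nat) (s : forall i, 'I_(b i) -> nat).
Variable D : forall i, 'M[R]_(b i.+1, b i).
Arguments s : clear implicits.
Hypothesis D_homog : forall i, homogeneous_mx (s i) (s i.+1) (D i).
Hypothesis D_exact : forall i (v : 'rV[R]_(b i.+1)), v *m D i = 0 <-> exists w, v = w *m D i.+1.

Definition tail_vec c k (v : 'rV[R]_c) : Prop := forall l, tail_ideal k (v 0 l).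

Lemma tail_vecD c k (u v : 'rV[R]_c) : tail_vec k u -> tail_vec k v -> tail_vec k (u + v).
Proof. by move=> hu hv l; rewrite mxE; apply: tail_idealD. Qed.

Lemma tail_vecB c k (u v : 'rV[R]_c) : tail_vec k u -> tail_vec k v -> tail_vec k (u - v).
Proof. by move=> hu hv l; rewrite !mxE; apply: tail_idealB. Qed.

Lemma tail_vec0 c k : tail_vec k (0 : 'rV[R]_c).
Proof. by move=> l; rewrite mxE; apply: tail_ideal0. Qed.

Lemma tail_vecZ c k a (v : 'rV[R]_c) : tail_vec k v -> tail_vec k (a *: v).
Proof. by move=> hv l; rewrite !mxE; apply: tail_idealM. Qed.

Lemma tail_vec_mul c c' k (v : 'rV[R]_c) (E : 'M[R]_(c, c')) :
  tail_vec k v -> tail_vec k (v *m E).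
Proof.
move=> hv l; rewrite mxE; elim/big_rec: _ => [|i x _ hx]; first exact: tail_ideal0.
by apply: tail_idealD => //; rewrite mulrC; apply: tail_idealM.
Qed.

Lemma tail_vec_le c k k' (v : 'rV[R]_c) : (k <= k')%N -> tail_vec k v -> tail_vec k' v.
Proof. by move=> kk' hv l; apply: tail_ideal_le (hv l). Qed.

Lemma tail_vecX c (k : 'I_n) (v : 'rV[R]_c) : tail_vec k.+1 ('X_(rev_ord k) *: v).
Proof. by move=> l; rewrite mxE; apply: tail_idealX. Qed.

Lemma tail_vec_reg c (k : 'I_n) (v : 'rV[R]_c) :
  tail_vec k ('X_(rev_ord k) *: v) -> tail_vec k v.
Proof. by move=> hv l; apply: tail_ideal_reg; move: (hv l); rewrite mxE. Qed.

Lemma tail_vec_div c (t : 'I_c -> nat) (k : 'I_n) j (v : 'rV[R]_c) :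
  homogeneous t j.+1 v -> tail_vec k.+1 v ->
  exists2 w, homogeneous t j w & tail_vec k (v - 'X_(rev_ord k) *: w).
Proof.
move=> hv kv; pose Q l g := tail_ideal k (v 0 l - 'X_(rev_ord k) * g) /\
  forall m, m \in msupp g -> (m + U_(rev_ord k))%MM \in msupp (v 0 l).
have /(_ _)/constructive_indefinite_description w : forall l, exists g, Q l g.
  by move=> l; have [g g1 g2] := tail_ideal_div (kv l); exists g.
exists (\row_l proj1_sig (w l)) => l.
  rewrite mxE => m; case: (w l) => g [_ hg] /= /hg /hv.
  by rewrite mdegD mdeg1; lia.
by rewrite !mxE; case: (w l) => g [].
Qed.

Definition tail_cycle (k i : nat) : 'rV[R]_(b i) -> Prop :=
  match i with 0 => fun _ => True | i'.+1 => fun v => tail_vec k (v *m D i') end.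

Definition tail_boundary (k i j : nat) (v : 'rV[R]_(b i)) : Prop :=
  exists2 w, homogeneous (s i.+1) j w & tail_vec k (v - w *m D i).

(* H_i(F / Q_k F)_j = 0, where F is the resolution and Q_k = tail_ideal k. *)
Definition tail_acyclic (k i j : nat) : Prop :=
  forall v, homogeneous (s i) j v -> @tail_cycle k i v -> @tail_boundary k i j v.

(* Multiplication by the (k+1)-st variable from the end is injective on
   H_i(F / Q_k F)_j. *)
Definition tail_injective (k : 'I_n) (i j : nat) : Prop :=
  forall w, homogeneous (s i) j w -> @tail_cycle k i w ->
    @tail_boundary k i j.+1 ('X_(rev_ord k) *: w) -> @tail_boundary k i j w.

Lemma DD0 i (v : 'rV[R]_(b i.+2)) : v *m D i.+1 *m D i = 0.
Proof. by apply/D_exact; exists v. Qed.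

(** Exactness of H_(i+1)(F/Q_k)_(j+1) -> H_(i+1)(F/Q_(k+1))_(j+1) -> H_i(F/Q_k)_j at its middle
    term, where the second map is the connecting map: its image is the kernel of multiplication by
    the new variable. *)
Lemma tail_acyclicS (k : 'I_n) i j :
  tail_acyclic k i.+1 j.+1 -> tail_injective k i j -> tail_acyclic k.+1 i.+1 j.+1.
Proof.
move=> hk hinj v hv /= cv.
(* The class of [w] is the image of [v] under the connecting map. *)
have [w hw qw] := tail_vec_div (homogeneous_mul (@D_homog i) hv) cv.
have wE : tail_vec k ('X_(rev_ord k) *: w - v *m D i).
  by rewrite -opprB -scaleN1r; apply: tail_vecZ.
have cw : @tail_cycle k i w.
  case: i v w hv cv hw qw wE {hk hinj} => //= i v w _ _ _ _ wE.
  apply: tail_vec_reg; have := tail_vec_mul (D i) wE.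
  by rewrite mulmxBl DD0 subr0 -scalemxAl.
have [u hu qu] := hinj w hw cw (ex_intro2 _ _ v hv wE).
have hXu : homogeneous (s i.+1) j.+1 (v - 'X_(rev_ord k) *: u).
  by apply: homogeneousB => //; have := homogeneousX (m := U_(rev_ord k)%MM) hu; rewrite mdeg1.
have [|z hz qz] := hk _ hXu.
  rewrite /= mulmxBl -scalemxAl.
  have -> : v *m D i - 'X_(rev_ord k) *: (u *m D i) =
     (v *m D i - 'X_(rev_ord k) *: w) + 'X_(rev_ord k) *: (w - u *m D i).
    by rewrite scalerBr addrA subrK.
  by apply: tail_vecD => //; apply: tail_vecZ.
exists z => //; rewrite -[v](subrK ('X_(rev_ord k) *: u)) -addrA [_ *: u - _]addrC addrA.
by apply: tail_vecD; [apply: tail_vec_le qz | apply: tail_vecX].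
Qed.

Lemma tail_acyclic0S k j : tail_acyclic k 0 j -> tail_acyclic k.+1 0 j.
Proof.
move=> h v hv _; have [w hw q] := h v hv Logic.I.
by exists w => //; apply: tail_vec_le q.
Qed.

(** If x w is the boundary of [v] modulo Q_k, then [v] is a cycle modulo Q_(k+1), hence a boundary
    plus x z modulo Q_k. Applying the differential and cancelling x shows that [w] is the boundary
    of [z]. *)
Lemma tail_acyclic_injective (k : 'I_n) i j :
  tail_acyclic k.+1 i.+1 j.+1 -> tail_injective k i j.
Proof.
move=> h w hw cw [v hv qv].
have [|u hu qu] := h v hv.
  rewrite /= -[v *m _]opprK -[- (_ *m _)](addKr ('X_(rev_ord k) *: w)) opprD opprK.
  by apply: tail_vecB; [apply: tail_vecX | apply: tail_vec_le qv].
have [z hz qz] := tail_vec_div (homogeneousB hv (homogeneous_mul (@D_homog i.+1) hu)) qu.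
exists z => //; apply: tail_vec_reg.
rewrite scalerBr scalemxAl.
have -> : 'X_(rev_ord k) *: w - ('X_(rev_ord k) *: z) *m D i =
   ('X_(rev_ord k) *: w - v *m D i) + (v - u *m D i.+1 - 'X_(rev_ord k) *: z) *m D i.
  by rewrite !mulmxBl DD0 subr0 addrA subrK.
by apply: tail_vecD => //; apply: tail_vec_mul.
Qed.

Lemma tail_acyclic_upward r k0 k : (k0 <= k <= n)%N ->
  (forall i j, (r + i < j)%N -> tail_acyclic k0 i j) ->
  forall i j, (r + i < j)%N -> tail_acyclic k i j.
Proof.
move=> /andP[+ +] h0; elim: k => [|k IH]; first by rewrite leqn0 => /eqP <-.
rewrite leq_eqVlt => /predU1P[<-//|k0k] kn.
have {}IH := IH k0k (ltnW kn).
move=> [|i] [|j] // ij; first by apply/tail_acyclic0S/IH.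
apply: (@tail_acyclicS (Ordinal kn)); first exact: IH.
by move=> w hw cw _; apply: IH => //; lia.
Qed.

(** Multiplication by the next variable sends degree [r + i] to degree [r + i + 1], where H_i
    vanishes. It cannot be injective on a nonzero group, so by [tail_acyclic_injective] the next
    H_(i+1) is nonzero in degree [r + i + 1]. *)
Lemma tail_homology_upward r k0 k : (k0 <= k <= n)%N ->
  (forall i j, (r + i < j)%N -> tail_acyclic k0 i j) ->
  (exists i, ~ tail_acyclic k0 i (r + i)) -> exists i, ~ tail_acyclic k i (r + i).
Proof.
move=> /andP[+ +] h0 hex; elim: k => [|k IH]; first by rewrite leqn0 => /eqP <-.
rewrite leq_eqVlt => /predU1P[<-//|k0k] kn.
have [i hi] := IH k0k (ltnW kn).
exists i.+1 => h; apply: hi => v hv cv.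
rewrite addnS in h; have inj := @tail_acyclic_injective (Ordinal kn) i (r + i)%N h.
apply: inj => //.
apply: (@tail_acyclic_upward r k0 k) => //; first by apply/andP; split; [exact: k0k | exact: ltnW].
- by have := homogeneousX (m := U_(rev_ord (Ordinal kn))%MM) hv; rewrite mdeg1.
case: i v cv {h hv} => //= i v cv.
by rewrite -scalemxAl; apply: tail_vecZ.
Qed.

Hypothesis D_minimal : forall i k l, (D i k l)@_0%MM = 0.

(** By minimality the differential vanishes modulo all variables, so the homology is F_i tensored
    with K, which has one basis vector in degree [s i l] for each [l]. *)
Lemma tail_acyclic_full i j : tail_acyclic n i j <-> forall l, s i l <> j.
Proof.
have Dtail i' (w : 'rV[R]_(b i'.+1)) : tail_vec n (w *m D i').
  move=> l; rewrite mxE; elim/big_rec: _ => [|k x _ hx]; first exact: tail_ideal0.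
  by apply: tail_idealD => //; apply: tail_idealM; apply/tail_ideal_full.
have cyc i' (w : 'rV[R]_(b i')) : @tail_cycle n i' w by case: i' w => //=.
split=> [h l sl|h v hv _]; last first.
  exists 0 => [l m|l]; first by rewrite mxE msupp0.
  rewrite mul0mx subr0; apply/tail_ideal_full; apply: memN_msupp_eq0.
  by apply/negP => /hv; rewrite mdeg0; apply: h.
have [||w hw qw] := h (delta_mx 0 l).
- move=> l' m; rewrite mxE eqxx /=; have [->|_] := eqVneq l' l; last by rewrite msupp0.
  by rewrite msupp1 inE => /eqP ->; rewrite mdeg0.
- exact: cyc.
move: (tail_vecD qw (Dtail i w)) => /(_ l).
by rewrite subrK mxE !eqxx => /tail_ideal_full; rewrite mcoeff1 eqxx => /eqP; rewrite oner_eq0.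
Qed.

Lemma regularity_of_tail_homology r k0 : (k0 <= n)%N ->
  (forall i j, (r + i < j)%N -> tail_acyclic k0 i j) ->
  (exists i, ~ tail_acyclic k0 i (r + i)) ->
  (forall i k, (s i k <= r + i)%N) /\ exists i k, s i k = (r + i)%N.
Proof.
move=> k0n h0 hex; split=> [i k|].
  rewrite leqNgt; apply/negP => lt.
  have := @tail_acyclic_upward r k0 n _ h0 i (s i k) lt; rewrite k0n leqnn => /(_ isT).
  by move=> /tail_acyclic_full /(_ k).
have := @tail_homology_upward r k0 n _ h0 hex; rewrite k0n leqnn => /(_ isT)[i hi].
exists i; apply: NNPP => h; apply: hi; apply/tail_acyclic_full => l sl.
by apply: h; exists l.
Qed.

End Descent.

(** * Reverse lexicographic initial ideals *)

Section RevLex.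
Variable n : nat.
Implicit Types a b c m : 'X_{1..n}.

(** Within one degree, reversing exponents turns [drl_lt] into the opposite of [<%O], so that
    totality and transitivity can be borrowed from the latter. *)
Definition rev_mnm m : 'X_{1..n} := [multinom m (rev_ord i) | i < n].

Lemma rev_mnm_inj : injective rev_mnm.
Proof.
move=> a b /mnmP e; apply/mnmP => i; move: (e (rev_ord i)).
by rewrite !mnmE rev_ordK.
Qed.

Lemma mdeg_rev_mnm m : mdeg (rev_mnm m) = mdeg m.
Proof.
rewrite !mdegE [RHS](reindex_inj rev_ord_inj) /=.
by apply: eq_bigr => i _; rewrite mnmE.
Qed.

Lemma drl_ltE a b : mdeg a = mdeg b -> drl_lt b a = (rev_mnm a < rev_mnm b)%O.
Proof.
move=> e; rewrite /drl_lt e ltnn eqxx /=.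
have e' : mdeg (rev_mnm a) = mdeg (rev_mnm b) by rewrite !mdeg_rev_mnm.
apply/existsP/(ltmcP e') => [[i /andP[lt /forallP h]]|[i h lt]].
  exists (rev_ord i); last by rewrite !mnmE rev_ordK.
  move=> j ji; rewrite !mnmE; apply/eqP; move: (h (rev_ord j)) => /implyP; apply.
  by move: ji => /=; have := ltn_ord i; have := ltn_ord j; lia.
exists (rev_ord i); rewrite !mnmE in lt; rewrite lt /=.
apply/forallP => j; apply/implyP => ij; apply/eqP.
have := h (rev_ord j); rewrite !mnmE rev_ordK; apply.
by move: ij => /=; have := ltn_ord i; have := ltn_ord j; lia.
Qed.

Lemma drl_lt_add2r c a b : drl_lt (a + c)%MM (b + c)%MM = drl_lt a b.
Proof.
rewrite /drl_lt !mdegD ltn_add2r eqn_add2r; congr (_ || _ && _).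
apply: eq_existsb => i; rewrite !mnmDE ltn_add2r; congr (_ && _).
by apply: eq_forallb => j; rewrite !mnmDE eqn_add2r.
Qed.

(** The comparison is decided at the last variable occurring in [m]: it is among the last [k], so
    [w] has exponent 0 there and at all later places. *)
Lemma drl_lt_tail k m w : mdeg m = mdeg w -> tail_free k w -> ~~ tail_free k m ->
  drl_lt m w.
Proof.
move=> e /tail_freeP kw; rewrite negb_forall => /existsP[i0].
rewrite negb_imply => /andP[ki0 mi0].
rewrite /drl_lt e eqxx orbC /=; apply/orP; left.
case: (@arg_maxnP _ i0 (fun i => m i != 0%N) (fun i => i : nat) mi0) => i mi imax.
have ki : (n - k <= i)%N by apply: leq_trans ki0 (imax _ mi0).
apply/existsP; exists i; rewrite (kw _ ki) lt0n mi /=.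
apply/forallP => j; apply/implyP => ij; rewrite kw ?(leq_trans ki (ltnW ij)) //.
by rewrite eq_sym; apply/negPn/negP => /imax /=; rewrite leqNgt ij.
Qed.

Lemma revlex_lead (K : fieldType) k (f : {mpoly K[n]}) w : tail_free k w -> f@_w != 0 ->
  (forall m, m \in msupp f -> mdeg m = mdeg w) ->
  (forall m, tail_free k m -> m \in msupp f -> m != w -> drl_lt m w) ->
  is_lead_monomial f w.
Proof.
move=> kw fw hd h; split=> [|m mf mw]; first by rewrite mcoeff_msupp.
have [km|km] := boolP (tail_free k m); first exact: h.
by apply: drl_lt_tail km; rewrite ?hd.
Qed.

Lemma lead_monomial_exists (K : fieldType) d (f : {mpoly K[n]}) : f != 0 ->
  (forall m, m \in msupp f -> mdeg m = d) -> exists m, is_lead_monomial f m.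
Proof.
rewrite -msupp_eq0 => f0 hd.
suff [m mf hm] : exists2 m, m \in msupp f &
    forall m', m' \in msupp f -> (rev_mnm m <= rev_mnm m')%O.
  exists m; split=> // m' m'f m'm; rewrite drl_ltE; last by rewrite !hd.
  by rewrite lt_neqAle hm // andbT (inj_eq rev_mnm_inj) eq_sym.
elim: (msupp f) f0 => // m [|m1 s] IH _.
  by exists m; rewrite ?mem_head // => m'; rewrite inE => /eqP->.
have [//|m2 m2s hm2] := IH.
have [le|/ltW le] := leP (rev_mnm m) (rev_mnm m2).
  exists m; first exact: mem_head.
  by move=> m'; rewrite inE => /predU1P[->//|/hm2]; apply: le_trans.
exists m2; first by rewrite inE m2s orbT.
by move=> m'; rewrite inE => /predU1P[->//|/hm2].
Qed.

End RevLex.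

(** * Initial ideals and normal forms *)

Section InitialIdeal.
Variables (K : fieldType) (n : nat).
Local Notation R := {mpoly K[n]}.
Implicit Types (I L : R -> Prop) (f g : R) (m : 'X_{1..n}).

Lemma ideal_gen_mul (S : R -> Prop) a f : ideal_gen S f -> ideal_gen S (a * f).
Proof.
case=> t [tS ->]; exists [seq (a * q.1, q.2) | q <- t]; split=> [q|].
  by case/mapP => q' /tS ? ->.
by rewrite big_map mulr_sumr; apply: eq_bigr => q _; rewrite mulrA.
Qed.

Lemma ideal_gen_mono (S T : R -> Prop) f :
  (forall g, S g -> T g) -> ideal_gen S f -> ideal_gen T f.
Proof. by move=> ST [t [tS ->]]; exists t; split=> // q /tS /ST. Qed.

Lemma ideal_gen_base (S : R -> Prop) f : S f -> ideal_gen S f.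
Proof.
move=> Sf; exists [:: (1, f)]; split=> [q|]; first by rewrite inE => /eqP->.
by rewrite big_seq1 mul1r.
Qed.

Lemma initial_ideal_mono I L f :
  (forall g, I g -> L g) -> initial_ideal I f -> initial_ideal L f.
Proof.
by move=> IL; apply: ideal_gen_mono => g [h [m [Ih lm ->]]]; exists h, m; split=> //; apply: IL.
Qed.

Lemma lead_monomialM f m m' : is_lead_monomial f m -> is_lead_monomial (f * 'X_[m']) (m + m')%MM.
Proof.
move=> [mf hm]; split=> [|m1].
  by rewrite (perm_mem (msuppMX _ _)) addmC map_f.
rewrite (perm_mem (msuppMX _ _)) => /mapP[m2 m2f ->].
by rewrite addmC eqm_add2r drl_lt_add2r; apply: hm.
Qed.

(** A monomial occurring in a combination of leading monomials is a multiple of one of them, and a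
    monomial multiple of an element of [I] has the corresponding leading monomial. *)
Lemma initial_ideal_monomial I m : is_ideal I ->
  initial_ideal I 'X_[m] <-> exists2 f, I f & is_lead_monomial f m.
Proof.
move=> [I0 ID IM]; split=> [[t [tS e]]|[f If lf]]; last first.
  by apply: ideal_gen_base; exists f, m.
have : (\sum_(q <- t) q.1 * q.2)@_m != 0 by rewrite -e mcoeffX eqxx oner_eq0.
have [/hasP[q qt qm] _|/hasPn h] := boolP (has (fun q => (q.1 * q.2)@_m != 0) t); last first.
  by rewrite raddf_sum big_seq big1 ?eqxx //= => q /h /negPn/eqP.
have [f [m' [If lf q2]]] := tS q qt.
move: qm; rewrite q2 -mcoeff_msupp (perm_mem (msuppMX _ _)) => /mapP[m1 _ mE].
exists (f * 'X_[m1]); first by rewrite mulrC; apply: IM.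
by rewrite mE; apply: lead_monomialM.
Qed.

Lemma pihomog_hpart d f : pihomog mdeg d f = hpart 0 d f.
Proof. by rewrite /hpart subn0. Qed.

Lemma homog_initial_ideal I m : is_homog_ideal I -> initial_ideal I 'X_[m] ->
  exists f, [/\ I f, forall m', m' \in msupp f -> mdeg m' = mdeg m & is_lead_monomial f m].
Proof.
move=> [II Ih] /(initial_ideal_monomial _ II)[f If [mf hm]].
exists (pihomog mdeg (mdeg m) f).
have sE m' : (m' \in msupp (pihomog mdeg (mdeg m) f)) = (mdeg m' == mdeg m) && (m' \in msupp f).
  by rewrite !mcoeff_msupp mcoeff_pihomog; have [_|_] := eqVneq (mdeg m') (mdeg m); rewrite ?eqxx.
split; first exact: Ih.
- by move=> m'; rewrite sE => /andP[/eqP].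
by split=> [|m']; rewrite sE ?eqxx // => /andP[_]; apply: hm.
Qed.

Lemma ideal_initial I m : is_ideal I -> I 'X_[m] -> initial_ideal I 'X_[m].
Proof.
move=> II Im; apply/initial_ideal_monomial => //; exists 'X_[m] => //.
by split=> [|m']; rewrite msuppX inE // => ->.
Qed.

Lemma idealB I f g : is_ideal I -> I f -> I g -> I (f - g).
Proof. by case=> _ ID IM If Ig; rewrite -mulN1r; apply: ID => //; apply: IM. Qed.

(** The leading term is cancelled by elements of [I] until the leading monomial is standard. The
    process cannot end at 0, since [f] is not in [I]. *)
Lemma normal_form I d f : is_homog_ideal I ->
  (forall m, m \in msupp f -> mdeg m = d) -> ~ I f ->
  exists f' m, [/\ I (f - f'), forall m', m' \in msupp f' -> mdeg m' = d,
    is_lead_monomial f' m & ~ initial_ideal I 'X_[m]].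
Proof.
move=> hI; have [II Ih] := hI; have [I0 ID IM] := II.
(* In degree [d] these are the monomials below [m] in the reverse lexicographic order. The set is
   finite and shrinks at each reduction, which gives termination. *)
pose above m := [set m' : 'X_{1..n < d.+1} | (rev_mnm m < rev_mnm m')%O].
suff main N : forall f m, (#|above m| < N)%N ->
    (forall m, m \in msupp f -> mdeg m = d) -> is_lead_monomial f m -> ~ I f ->
    exists f' m, [/\ I (f - f'), forall m', m' \in msupp f' -> mdeg m' = d,
      is_lead_monomial f' m & ~ initial_ideal I 'X_[m]].
  move=> hf If; have f0 : f != 0 by apply/eqP => f0; apply: If; rewrite f0.
  by have [m lm] := lead_monomial_exists f0 hf; apply: (main #|above m|.+1) lm If.
elim: N => // N IH {}f m; rewrite ltnS => mN hf lf If.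
case: (classic (initial_ideal I 'X_[m])) => Im; last first.
  by exists f, m; split=> //; rewrite subrr.
have [g [Ig hg lg]] := homog_initial_ideal hI Im.
have md : mdeg m = d by apply: hf; have [] := lf.
pose c := (f@_m / g@_m)%:MP : R.
have [mf hm] := lf; have [mg hm'] := lg.
have If1 : ~ I (f - c * g).
  by move=> h; apply: If; rewrite -(subrK (c * g) f); apply: ID => //; apply: IM.
have s1 m' : m' \in msupp (f - c * g) -> m' != m /\ (m' \in msupp f \/ m' \in msupp g).
  move=> m'f; split.
    apply/eqP => e; move: m'f; rewrite e mcoeff_msupp mcoeffB mcoeffCM divfK ?subrr ?eqxx //.
    by rewrite -mcoeff_msupp.
  move: m'f => /msuppB_le; rewrite mem_cat => /orP[->|]; first by left.
  by rewrite mul_mpolyC => /msuppZ_le ->; right.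
have hf1 m' : m' \in msupp (f - c * g) -> mdeg m' = d.
  by move=> /s1 [_ [/hf|/hg ->]].
have f10 : f - c * g != 0 by apply/eqP => e; apply: If1; rewrite e.
have [m1 lm1] := lead_monomial_exists f10 hf1.
have [|//|f' [m2 [h1 h2 h3 h4]]] := IH (f - c * g) m1 _ hf1 lm1.
- apply: leq_trans mN; apply: proper_card; apply/properP; split.
    have [/s1 [m1m h] _] := lm1.
    apply/subsetP => m'; rewrite !inE; apply: lt_trans.
    rewrite -drl_ltE; last by rewrite md hf1 //; have [] := lm1.
    by case: h => [/hm|/hm']; apply.
  have [m1s _] := lm1.
  have m1d : (mdeg m1 < d.+1)%N by rewrite hf1.
  have [m1m h] := s1 _ m1s.
  exists (BMultinom m1d); rewrite !inE /= ?ltxx //.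
  rewrite -drl_ltE; last by rewrite md hf1.
  by case: h => [/hm|/hm']; apply.
exists f', m2; split=> //; rewrite -[f](subrK (c * g)) addrAC.
by apply: ID => //; apply: IM.
Qed.

Lemma ideal_sum_homog I k : is_homog_ideal I -> is_homog_ideal (ideal_sum I (@tail_ideal K n k)).
Proof.
move=> [[I0 ID IM] Ih]; split; first split.
- by exists 0, 0; split; rewrite ?addr0 //; apply: tail_ideal0.
- move=> _ _ [g [h [Ig Qh ->]]] [g' [h' [Ig' Qh' ->]]].
  exists (g + g'), (h + h'); rewrite addrACA; split=> //; first exact: ID.
  exact: tail_idealD.
- move=> a _ [g [h [Ig Qh ->]]]; exists (a * g), (a * h).
  by rewrite mulrDr; split=> //; [apply: IM | apply: tail_idealM].
move=> _ d [g [h [Ig Qh ->]]]; exists (pihomog mdeg d g), (pihomog mdeg d h).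
split; [exact: Ih | | by rewrite raddfD].
by rewrite pihomog_hpart; apply: tail_ideal_hpart.
Qed.

Lemma ideal_sumL I k f : I f -> ideal_sum I (@tail_ideal K n k) f.
Proof. by move=> If; exists f, 0; split; rewrite ?addr0 //; apply: tail_ideal0. Qed.

Lemma ideal_sumR I k f : is_ideal I -> tail_ideal k f -> ideal_sum I (@tail_ideal K n k) f.
Proof. by case=> I0 _ _ kf; exists 0, f; split; rewrite ?add0r. Qed.

End InitialIdeal.

(** * The resolution modulo the last two variables *)

Section BaseCase.
Variables (K : fieldType) (n : nat).
Local Notation R := {mpoly K[n]}.
Variable I : R -> Prop.
Hypothesis I_homog : is_homog_ideal I.
Variables (b : nat -> nat) (s : forall i, 'I_(b i) -> nat).
Variables (D : forall i, 'M[R]_(b i.+1, b i)) (e : 'cV[R]_(b 0)).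
Hypothesis Fres : @minimal_graded_free_resolution K n I b s D e.
Arguments s : clear implicits.

Let aug (v : 'rV[R]_(b 0)) : R := (v *m e) 0 0.

Lemma resolution_homog i : homogeneous_mx (s i) (s i.+1) (D i).
Proof. by case: Fres => -[_ h] _ _ _ k l m; rewrite mxE; apply: h. Qed.

Lemma augmentation_homog : homogeneous_mx (fun _ : 'I_1 => 0%N) (s 0) e.
Proof.
case: Fres => -[h _] _ _ _ k l m; rewrite mxE ord1 => /h ->.
by rewrite addn0.
Qed.

Lemma augD u v : aug (u + v) = aug u + aug v.
Proof. by rewrite /aug mulmxDl mxE. Qed.

Lemma augZ a v : aug (a *: v) = a * aug v.
Proof. by rewrite /aug -scalemxAl mxE. Qed.

Lemma aug_gpart d v : aug (gpart (s 0) d v) = hpart 0 d (aug v).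
Proof. by rewrite /aug -(gpart_mul d v augmentation_homog) mxE. Qed.

Lemma aug_surj : forall f, exists v, I (f - aug v).
Proof. by case: Fres => _ [h _] _ _; apply: h. Qed.

Lemma aug_ker v : I (aug v) <-> exists w, v = w *m D 0%N.
Proof. by case: Fres => _ [_ h] _ _; apply: h. Qed.

Lemma aug_surj_homog d f : (forall m, m \in msupp f -> mdeg m = d) ->
  exists2 v, homogeneous (s 0%N) d v & I (f - aug v).
Proof.
move=> hf; have [v hv] := aug_surj f.
exists (gpart (s 0%N) d v); first exact: gpart_homog.
rewrite aug_gpart; have -> : f = hpart 0 d f.
  apply/mpolyP => m; rewrite mcoeff_hpart addn0.
  have [mf|mf] := boolP (m \in msupp f); first by rewrite hf ?eqxx.
  by rewrite (memN_msupp_eq0 mf) if_same.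
rewrite -!pihomog_hpart -raddfB; have [_] := I_homog; exact.
Qed.

(** The augmentation identifies H_0(F/Q_k) with R/(I + Q_k). *)
Lemma tail_boundary0 k d v : homogeneous (s 0%N) d v ->
  tail_boundary s D k d v <-> ideal_sum I (tail_ideal k) (aug v).
Proof.
have [[I0 ID IM] Ih] := I_homog; move=> hv; split=> [[w hw qw]|[a [q [Ia kq avE]]]].
  exists (aug (w *m D 0%N)), (aug (v - w *m D 0%N)); split.
  - by apply/aug_ker; exists w.
  - exact: (tail_vec_mul e qw).
  - by rewrite -augD addrC subrK.
(* With [u] a lift of 1, the vector [q *: u] lies in Q_k F and maps to [q] modulo [I], so
   subtracting it brings [v] into the kernel. Taking the part of degree [d] then makes the witness
   homogeneous. *)
have [u Iu] := aug_surj 1.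
have /aug_ker[w vw] : I (aug (v - q *: u)).
  rewrite -scaleN1r scalerA augD augZ avE.
  have -> : a + q + -1 * q * aug u = a + q * (1 - aug u) by ring.
  by apply: ID => //; apply: IM.
exists (gpart (s 1%N) d w); first exact: gpart_homog.
rewrite -(gpart_mul d w (@resolution_homog 0%N)) -vw.
have -> : gpart (s 0%N) d (v - q *: u) = v - gpart (s 0%N) d (q *: u).
  by rewrite -{2}(gpart_id hv) -{2}(subrK (q *: u) v) [in RHS]gpartD addrK.
rewrite opprB addrC subrK => l; rewrite !mxE.
by apply: tail_ideal_hpart; rewrite mulrC; apply: tail_idealM.
Qed.

Lemma resolution_exact i (v : 'rV[R]_(b i.+1)) : v *m D i = 0 <-> exists w, v = w *m D i.+1.
Proof. by case: Fres => _ _ h _; apply: h. Qed.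

Lemma tail_acyclic_0 k d : tail_acyclic s D k 0 d <->
  forall f, (forall m, m \in msupp f -> mdeg m = d) -> ideal_sum I (@tail_ideal K n k) f.
Proof.
have hL := ideal_sum_homog k I_homog; have [[_ LD _] _] := hL.
split=> [h f hf|h v hv _].
  have [v hv Iv] := aug_surj_homog hf.
  rewrite -(subrK (aug v) f); apply: LD; first exact: ideal_sumL.
  by apply/(tail_boundary0 k hv); apply: h.
apply/(tail_boundary0 k hv); apply: h => m mv.
by have := homogeneous_mul augmentation_homog hv mv; rewrite addn0.
Qed.

Lemma tail_injective_0 (k : 'I_n) d : tail_injective s D k 0 d <->
  forall f, (forall m, m \in msupp f -> mdeg m = d) ->
    ideal_sum I (@tail_ideal K n k) ('X_(rev_ord k) * f) -> ideal_sum I (@tail_ideal K n k) f.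
Proof.
have hL := ideal_sum_homog k I_homog; have [LI _] := hL; have [_ LD LM] := LI.
have hX (v : 'rV[R]_(b 0)) :
    homogeneous (s 0%N) d v -> homogeneous (s 0%N) d.+1 (('X_(rev_ord k) : R) *: v).
  by move=> hv; have := homogeneousX (m := U_(rev_ord k)%MM) hv; rewrite mdeg1.
split=> [h f hf Lf|h v hv _ /(tail_boundary0 k (hX _ hv)) Lv].
  have [v hv Iv] := aug_surj_homog hf.
  have Lfv := ideal_sumL k Iv.
  rewrite -(subrK (aug v) f); apply: LD => //.
  apply/(tail_boundary0 k hv); apply: h => //.
  apply/(tail_boundary0 k (hX _ hv)); rewrite augZ.
  rewrite -[aug v](subKr f) mulrBr; apply: idealB => //; exact: LM.
apply/(tail_boundary0 k hv); apply: h; last by move: Lv; rewrite augZ.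
move=> m mv.
by have := homogeneous_mul augmentation_homog hv mv; rewrite addn0.
Qed.

Lemma tail_acyclic_resolution i d : tail_acyclic s D 0 i.+1 d.
Proof.
move=> v hv /= cv; have /resolution_exact[w vw] : v *m D i = 0.
  by apply/rowP => l; rewrite [RHS]mxE; apply/tail_ideal_eq0.
exists (gpart (s i.+2) d w); first exact: gpart_homog.
rewrite -(gpart_mul d w (@resolution_homog i.+1)) -vw gpart_id // subrr.
exact: tail_vec0.
Qed.

End BaseCase.

Section TwoVariables.
Variables (K : fieldType) (n : nat).
Local Notation R := {mpoly K[n.+2]}.
Variable I : R -> Prop.
Hypothesis I_homog : is_homog_ideal I.
Hypothesis xlast_regular : nonzerodivisor_mod I (xlast K n).

(** The index counts from the end: [rev_ord pen] is the variable [xpen]. *)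
Let pen : 'I_n.+2 := Ordinal (isT : (1 < n.+2)%N).

Lemma xlastE : xlast K n = 'X_(rev_ord ord0).
Proof. by congr 'X_(_); apply: val_inj; rewrite /= subn1. Qed.

Lemma xpenE : xpen K n = 'X_(rev_ord pen).
Proof. by congr 'X_(_); apply: val_inj; rewrite /= inordK ?subSS ?subn0 //; lia. Qed.

Section Resolution.
Variables (b : nat -> nat) (s : forall i, 'I_(b i) -> nat).
Variables (D : forall i, 'M[R]_(b i.+1, b i)) (e : 'cV[R]_(b 0)).
Hypothesis Fres : @minimal_graded_free_resolution K n.+2 I b s D e.
Arguments s : clear implicits.

Let hD := resolution_homog Fres.
Let exD := resolution_exact Fres.

Lemma tail_acyclic_1 i d : tail_acyclic s D 1 i.+1 d.+1.
Proof.
apply: (@tail_acyclicS _ _ b s D hD exD ord0); first exact: (tail_acyclic_resolution Fres).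
case: i => [|i]; last by move=> w hw cw _; apply: (tail_acyclic_resolution Fres).
apply/(tail_injective_0 I_homog Fres) => f _ [g [h [Ig /tail_ideal_eq0 -> fE]]].
apply: ideal_sumL; apply: xlast_regular.
by rewrite xlastE fE addr0.
Qed.

Lemma tail_acyclic_2_high i d : tail_acyclic s D 2 i.+2 d.+2.
Proof.
apply: (@tail_acyclicS _ _ b s D hD exD pen); first exact: tail_acyclic_1.
by move=> w hw cw _; apply: tail_acyclic_1.
Qed.

(** As H_1 vanishes modulo [xlast], the connecting map identifies H_1 modulo both variables with the
    annihilator of [xpen] in R/(I + (xlast)), one degree lower. *)
Lemma tail_acyclic_2_1 d : tail_acyclic s D 2 1 d.+1 <->
  forall f, (forall m, m \in msupp f -> mdeg m = d) ->
    ideal_sum I (@tail_ideal K n.+2 1) (xpen K n * f) ->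
    ideal_sum I (@tail_ideal K n.+2 1) f.
Proof.
rewrite xpenE; split=> [h|/(tail_injective_0 I_homog Fres pen d) h].
  apply/(tail_injective_0 I_homog Fres pen d).
  exact: (@tail_acyclic_injective _ _ b s D hD exD pen).
by apply: (@tail_acyclicS _ _ b s D hD exD pen) => //; apply: tail_acyclic_1.
Qed.

Lemma regularity_of_quotients r :
  (forall d f, (r < d)%N -> (forall m, m \in msupp f -> mdeg m = d) ->
     ideal_sum I (@tail_ideal K n.+2 2) f) ->
  (forall d f, (r < d)%N -> (forall m, m \in msupp f -> mdeg m = d) ->
     ideal_sum I (@tail_ideal K n.+2 1) (xpen K n * f) ->
     ideal_sum I (@tail_ideal K n.+2 1) f) ->
  (exists2 f, forall m, m \in msupp f -> mdeg m = r &
     ~ ideal_sum I (@tail_ideal K n.+2 2) f) \/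
  (exists f, [/\ forall m, m \in msupp f -> mdeg m = r,
     ideal_sum I (@tail_ideal K n.+2 1) (xpen K n * f) &
     ~ ideal_sum I (@tail_ideal K n.+2 1) f]) ->
  has_CM_regularity I r.
Proof.
move=> h0 h1 hr; exists b, s, D, e.
have [_ _ _ Dmin] := Fres.
suff [hle hex] : (forall i k, (s i k <= r + i)%N) /\ exists i k, s i k = (r + i)%N by split.
apply: (@regularity_of_tail_homology _ _ b s D hD exD Dmin r 2) => //.
  (* For [i] positive, the bound r + i < j excludes the degrees too low for [tail_acyclic_2_1] and
     [tail_acyclic_2_high]. *)
  move=> [|[|i]] [|[|d]] //; rewrite ?addnS // => rd.
  - by apply/(tail_acyclic_0 I_homog Fres) => f; apply: h0; lia.
  - by apply/(tail_acyclic_0 I_homog Fres) => f; apply: h0; lia.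
  - by apply/tail_acyclic_2_1 => f; apply: h1; lia.
  - exact: tail_acyclic_2_high.
case: hr => [[f hf Lf]|[f [hf Lxf Lf]]].
  exists 0%N; rewrite addn0 => /(tail_acyclic_0 I_homog Fres) h.
  by apply: Lf; apply: h.
exists 1%N; rewrite addn1 => /tail_acyclic_2_1 h.
by apply: Lf; apply: h.
Qed.

End Resolution.
End TwoVariables.

(** * Standard monomials *)

Lemma is_max_exists (S : nat -> Prop) B :
  (exists k, S k) -> (forall k, S k -> (k <= B)%N) -> exists r, is_max S r.
Proof.
move=> [k Sk] SB; have [|j [Sj jB] jmin] := @nat_minimum (fun j => S (B - j)%N /\ (j <= B)%N).
  by exists (B - k)%N; rewrite subKn ?leq_subr //; apply: SB.
exists (B - j)%N; split=> // q Sq; have qB := SB q Sq.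
have := jmin (B - q)%N; rewrite subKn // leq_subr => /(_ (conj Sq isT)); lia.
Qed.

Lemma bounded_on (T : eqType) (t : seq T) (P : T -> nat -> Prop) :
  (forall x, exists B, forall k, P x k -> (k <= B)%N) ->
  exists B, forall x k, x \in t -> P x k -> (k <= B)%N.
Proof.
move=> h; elim: t => [|x t [B hB]]; first by exists 0%N.
have [B' hB'] := h x; exists (B + B')%N => y k; rewrite inE => /predU1P[->|yt] Pk.
  by have := hB' k Pk; lia.
by have := hB y k yt Pk; lia.
Qed.

Section InitialOfSum.
Variables (K : fieldType) (n : nat) (I : {mpoly K[n]} -> Prop).
Hypothesis I_homog : is_homog_ideal I.

Lemma tail_ideal_monomial k m : ~~ tail_free k m -> tail_ideal k ('X_[m] : {mpoly K[n]}).
Proof.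
move=> km m' km'; rewrite mcoeffX; case: eqP => // e.
by move: km; rewrite e km'.
Qed.

(* In the reverse lexicographic order a monomial free of the last k variables
   beats, within its degree, all those that involve them. *)
Lemma initial_ideal_mod_tail k f a w : I a -> tail_ideal k (f - a) ->
  tail_free k w -> w \in msupp f ->
  (forall m, tail_free k m -> m \in msupp f -> m != w -> drl_lt m w) ->
  initial_ideal I 'X_[w].
Proof.
move=> Ia kfa kw wf h; have [II Ih] := I_homog.
have cE m : tail_free k m -> a@_m = f@_m.
  by move=> /kfa; rewrite mcoeffB => /eqP; rewrite subr_eq0 => /eqP->.
apply/initial_ideal_monomial => //; exists (pihomog mdeg (mdeg w) a); first exact: Ih.
apply: (revlex_lead kw) => [|m|m km]; rewrite ?mcoeff_msupp mcoeff_pihomog.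
- by rewrite eqxx cE // -mcoeff_msupp.
- by have [|] := eqVneq (mdeg m) (mdeg w); rewrite ?eqxx.
- case: ifP => _; last by rewrite eqxx.
  by rewrite cE // -mcoeff_msupp; apply: h.
Qed.

(** Together with the two lemmas that follow, this is the identity in(I + Q_k) = in(I) + Q_k on
    monomials, characteristic of the reverse lexicographic order. *)
Lemma initial_ideal_sum_tail k w : tail_free k w ->
  initial_ideal (ideal_sum I (@tail_ideal K n k)) 'X_[w] -> initial_ideal I 'X_[w].
Proof.
move=> kw /(homog_initial_ideal (ideal_sum_homog k I_homog))[f [[a [h [Ia kh fE]]] _ [wf hw]]].
apply: (@initial_ideal_mod_tail k f a) => //; first by rewrite fE addrC addKr.
by move=> m _; apply: hw.
Qed.

Lemma ideal_sum_tail_initial k w : initial_ideal I 'X_[w] ->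
  initial_ideal (ideal_sum I (@tail_ideal K n k)) 'X_[w].
Proof. by apply: initial_ideal_mono => g; apply: ideal_sumL. Qed.

Lemma tail_free_of_normal k w :
  ~ initial_ideal (ideal_sum I (@tail_ideal K n k)) 'X_[w] -> tail_free k w.
Proof.
move=> h; apply/negPn/negP => kw; apply: h.
have [LI _] := ideal_sum_homog k I_homog; have [II _] := I_homog.
by apply: ideal_initial => //; apply: ideal_sumR => //; apply: tail_ideal_monomial.
Qed.

End InitialOfSum.

(** * The sets B0 and B1, the exponents delta, and finiteness *)

Section MonomialInvariants.
Variables (K : fieldType) (n : nat).
Local Notation R := {mpoly K[n.+2]}.
Variable I : R -> Prop.
Hypothesis I_homog : is_homog_ideal I.

Let pen : 'I_n.+2 := Ordinal (isT : (1 < n.+2)%N).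
Let ipen : 'I_n.+2 := rev_ord pen.

Lemma ideal_gen_tail f :
  ideal_gen (fun g => g = xpen K n \/ g = xlast K n) f <-> tail_ideal 2 f.
Proof.
rewrite xpenE xlastE; split=> [[t [th ->]]|/(tail_ideal_div (k := pen))[g]].
  rewrite big_seq; elim/big_rec: _ => [|q x /th qE hx]; first exact: tail_ideal0.
  apply: tail_idealD => //; apply: tail_idealM; case: qE => ->.
    by rewrite -['X__]mulr1; apply: (@tail_idealX _ _ pen).
  apply: (@tail_ideal_le _ _ 1) => //.
  by rewrite -['X__]mulr1; apply: (@tail_idealX _ _ ord0).
move=> /(tail_ideal_div (k := ord0))[g' /tail_ideal_eq0 /eqP + _] _.
rewrite subr_eq0 => /eqP e.
exists [:: (g, 'X_(rev_ord pen)); (g', 'X_(rev_ord ord0))]; split=> [q|].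
  by rewrite !inE => /orP[] /eqP -> /=; [left | right].
rewrite big_cons big_seq1 /= [g' * _]mulrC -e [g * _]mulrC.
by rewrite addrC subrK.
Qed.

Lemma B0E u : B0 I u <-> ~ initial_ideal (ideal_sum I (@tail_ideal K n.+2 2)) 'X_[u].
Proof.
rewrite /B0; split=> h h'; apply: h; apply: initial_ideal_mono h' => _ [g [h [Ig Qh ->]]];
  by exists g, h; split=> //; apply/ideal_gen_tail.
Qed.

Lemma monomial_xpen u d : 'X_[u] * xpen K n ^+ d = 'X_[u + U_(ipen) *+ d] :> R.
Proof. by rewrite xpenE mpolyXn mpolyXD. Qed.

Lemma tail_free_xpen u d : tail_free 2 u -> tail_free 1 (u + U_(ipen) *+ d)%MM.
Proof.
move=> /tail_freeP hu; apply/tail_freeP => i hi.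
rewrite mnmDE hu; last lia.
rewrite mulmnE mnm1E -val_eqE /=; case: eqP => // e; lia.
Qed.

Lemma mdeg_xpen u d : mdeg (u + U_(ipen) *+ d) = (mdeg u + d)%N.
Proof. by rewrite mdegD mdegMn mdeg1 mul1n. Qed.

(** An element of [I] with leading monomial u xpen^d is divisible by [xpen] modulo [xlast]. The
    quotient is annihilated by [xpen], and minimality of [d] keeps it nonzero. *)
Lemma colon_of_delta u d : B1 I u -> is_delta I u d ->
  exists f, [/\ forall m, m \in msupp f -> mdeg m = (mdeg u + d - 1)%N,
    ideal_sum I (@tail_ideal K n.+2 1) (xpen K n * f) &
    ~ ideal_sum I (@tail_ideal K n.+2 1) f].
Proof.
move=> [/B0E Bu _] []; rewrite monomial_xpen => hd dmin.
have ku := tail_free_of_normal I_homog Bu.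
(* Exponent 0 is impossible because [u], being in B0, is not in in(I); hence the truncated
   subtraction of 1 is exact. *)
case: d hd dmin => [|d] hd dmin.
  by case: Bu; apply: ideal_sum_tail_initial; move: hd; rewrite mulm0n addm0.
have [f [If hf [wf hw]]] := homog_initial_ideal I_homog hd.
(* A monomial of [f] free of the last two variables would exceed the leading monomial, which
   involves [xpen]. *)
have kf : tail_ideal 2 f.
  move=> m km; apply: memN_msupp_eq0; apply/negP => mf.
  have nk : ~~ tail_free 2 (u + U_(ipen) *+ d.+1)%MM.
    apply/negP => /tail_freeP /(_ ipen); rewrite mnmDE mulmnE mnm1E eqxx mul1n addnS.
    by rewrite /= => /(_ _) h; have := h _; lia.
  have mw : m != (u + U_(ipen) *+ d.+1)%MM by apply: contra nk => /eqP <-.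
  have := hw m mf mw; rewrite drl_ltE ?hf // => lt.
  have := drl_lt_tail (esym (hf _ mf)) km nk; rewrite drl_ltE ?hf // => lt'.
  by have := lt_trans lt lt'; rewrite ltxx.
have [g kg hg] := tail_ideal_div (k := pen) kf.
have [II _] := I_homog; have [LI _] := ideal_sum_homog 1 I_homog.
have step w : (w + U_(ipen) *+ d.+1 = w + U_(ipen) *+ d + U_(ipen))%MM.
  by rewrite mulmSr addmA.
exists g; split=> [m /hg /hf||[a [h [Ia kh gE]]]].
- by rewrite mdegD mdeg1 mdeg_xpen; lia.
- rewrite xpenE -['X__ * g](subKr f); apply: idealB => //; first exact: ideal_sumL.
  exact: ideal_sumR.
suff /dmin : initial_ideal I ('X_[u] * xpen K n ^+ d) by rewrite ltnn.
rewrite monomial_xpen; apply: (@initial_ideal_mod_tail _ _ _ I_homog 1 g a) => //.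
- by rewrite gE addrC addKr.
- exact: tail_free_xpen.
- rewrite mcoeff_msupp -(mcoeffMX g U_(ipen)) [g * _]mulrC [(U_(_) + _)%MM]addmC -step.
  have := kg _ (tail_free_xpen d.+1 ku); rewrite mcoeffB => /eqP; rewrite subr_eq0 => /eqP <-.
  by rewrite -mcoeff_msupp.
- move=> m _ /hg mf mw; rewrite -(drl_lt_add2r U_(ipen)) -step; apply: hw => //.
  by rewrite step eqm_add2r.
Qed.

Lemma chi_monomial u d : tail_free 2 u -> chi 'X_[u + U_(ipen) *+ d] = 'X_[u] :> R.
Proof.
move=> /tail_freeP ku; rewrite /chi comp_mpolyX mpolyXE_id; apply: eq_bigr => i _.
rewrite tnth_mktuple; case: ltnP => hi; last first.
  by rewrite ku ?expr0 ?expr1n //; lia.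
rewrite mnmDE mulmnE mnm1E -val_eqE /=; case: eqP => e; last by rewrite mul0n addn0.
by exfalso; move: e => /=; lia.
Qed.

(** Reduced modulo I + (xlast), [f] has a standard leading monomial w = u xpen^k with [u] free of
    the last two variables. Then [w] is not in in(I) but w xpen is, so delta_u is k + 1 and deg w =
    deg u + delta_u - 1. *)
Lemma delta_of_colon t f : (forall m, m \in msupp f -> mdeg m = t) ->
  ideal_sum I (@tail_ideal K n.+2 1) (xpen K n * f) ->
  ~ ideal_sum I (@tail_ideal K n.+2 1) f ->
  exists u d, [/\ B1 I u, is_delta I u d & t = (mdeg u + d - 1)%N].
Proof.
move=> hf Lxf Lf; have hL := ideal_sum_homog 1 I_homog; have [LI _] := hL.
have [f' [w [Lff' hf' [wf' hw] nw]]] := normal_form hL hf Lf.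
have kw := tail_free_of_normal I_homog nw.
have nIw : ~ initial_ideal I 'X_[w] by move=> /(ideal_sum_tail_initial 1)/nw.
have [a [h [Ia kh xf'E]]] : ideal_sum I (@tail_ideal K n.+2 1) (xpen K n * f').
  rewrite -[f'](subKr f) mulrBr; apply: idealB => //.
  by have [_ _ LM] := LI; apply: LM.
pose k := w ipen; pose u := (w - U_(ipen) *+ k)%MM.
have wE : w = (u + U_(ipen) *+ k)%MM.
  apply/mnmP => i; rewrite mnmDE mnmBE mulmnE mnm1E.
  by case: eqP => [<-|_]; rewrite ?mul1n ?mul0n ?subn0 ?addn0 // subnn.
have ku : tail_free 2 u.
  rewrite (@tail_freeS _ pen); apply/andP; split.
    by apply/tail_freeP => i hi; rewrite mnmBE; move/tail_freeP: kw => /(_ i hi) ->.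
  by rewrite mnmBE mulmnE mnm1E eqxx mul1n subnn.
have uE j : 'X_[u] * xpen K n ^+ j = 'X_[u + U_(ipen) *+ j] :> R by exact: monomial_xpen.
have nIu : ~ initial_ideal I 'X_[u].
  by move=> Iu; apply: nIw; rewrite wE mpolyXD mulrC; apply: ideal_gen_mul.
have Iwe : initial_ideal I 'X_[u + U_(ipen) *+ k.+1].
  rewrite mulmSr addmA -wE.
  apply: (@initial_ideal_mod_tail _ _ _ I_homog 1 (xpen K n * f') a) => //.
  - by rewrite xf'E addrC addKr.
  - by rewrite wE -addmA -mulmSr; apply: tail_free_xpen.
  - by rewrite xpenE mulrC (perm_mem (msuppMX _ _)) addmC map_f.
  - move=> m _; rewrite xpenE mulrC (perm_mem (msuppMX _ _)) => /mapP[m' m'f ->].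
    by rewrite addmC eqm_add2r drl_lt_add2r; apply: hw.
exists u, k.+1; split; first split.
- by apply/B0E => /(initial_ideal_sum_tail I_homog ku).
- by apply: ideal_gen_base; exists 'X_[u + U_(ipen) *+ k.+1]; rewrite ?chi_monomial.
- split=> [|d']; rewrite uE // => Id'; rewrite ltnNge; apply/negP => dk; apply: nIw.
  rewrite wE -(subnK dk) addnC.
  have -> : (u + U_(ipen) *+ (d' + (k - d')))%MM = (U_(ipen) *+ (k - d') + (u + U_(ipen) *+ d'))%MM.
    by apply/mnmP => i; rewrite !mnmDE !mulmnE; lia.
  by rewrite mpolyXD; apply: ideal_gen_mul.
- by rewrite -(hf' w wf') wE mdeg_xpen; lia.
Qed.

Lemma comp_mpoly_tail (q : {mpoly K[2]}) :
  tail_ideal 2 (comp_mpoly [tuple xpen K n; xlast K n] q - (q@_0)%:MP).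
Proof.
have ht (i : 'I_2) : tail_ideal 2 (tnth [tuple xpen K n; xlast K n] i).
  apply/ideal_gen_tail; apply: ideal_gen_base.
  by case: i => -[|[|//]] ?; [left | right].
elim/mpolyind: q => [|c m p _ _ IH].
  by rewrite comp_mpoly0 mcoeff0 mpolyC0 subr0; apply: tail_ideal0.
rewrite comp_mpolyD mcoeffD mpolyCD opprD addrACA; apply: tail_idealD => //.
rewrite comp_mpolyZ comp_mpolyX mcoeffZ mcoeffX.
have [->|m0] := eqVneq m 0%MM.
  rewrite big1 => [|i _]; last by rewrite mnm0E expr0.
  by rewrite mulr1 -alg_mpolyC subrr; apply: tail_ideal0.
rewrite mulr0 mpolyC0 subr0 -mul_mpolyC; apply: tail_idealM.
have /existsP[i mi] : [exists i, m i != 0%N].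
  apply: contraNT m0; rewrite negb_exists => /forallP h; apply/eqP/mnmP => i.
  by rewrite mnm0E; apply/eqP/negPn.
rewrite (bigD1 i) //= -(prednK (n := m i)) ?lt0n // exprS -mulrA mulrC.
exact: tail_idealM.
Qed.

(** Modulo the last two variables, the coefficients of an integral equation for ['X_i] become
    constants. The ideal being homogeneous, the component of top degree, a pure power, lies in
    it. *)
Lemma variable_power (i : 'I_n.+2) : noether_normalization I [tuple xpen K n; xlast K n] ->
  exists d, ideal_sum I (@tail_ideal K n.+2 2) ('X_i ^+ d).
Proof.
case=> _ /(_ 'X_i) [p pm Ip]; exists (size p).-1.
have hL := ideal_sum_homog 2 I_homog; have [LI Lh] := hL; have [L0 LD LM] := LI.
pose t := [tuple xpen K n; xlast K n].
(* The integral equation with every coefficient replaced by its constant term. *)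
pose c := \sum_(j < size p) (p`_j)@_0 *: 'X_[U_(i) *+ j] : R.
have Lc : ideal_sum I (@tail_ideal K n.+2 2) c.
  have := ideal_sumL 2 Ip; rewrite (horner_coef_wide _ (size_poly _ _)) => Lp.
  rewrite -[c](subKr (\sum_(j < size p) (map_poly (comp_mpoly t) p)`_j * 'X_i ^+ j)).
  apply: idealB => //; apply: ideal_sumR; first by have [] := I_homog.
  rewrite -sumrB; elim/big_rec: _ => [|j x _ hx]; first exact: tail_ideal0.
  apply: tail_idealD => //; rewrite coef_map mpolyXn -mul_mpolyC -mulrBl mulrC.
  by apply: tail_idealM; apply: comp_mpoly_tail.
have szp : (0 < size p)%N by rewrite lt0n size_poly_eq0 monic_neq0.
have := Lh c (size p).-1 Lc; congr (ideal_sum _ _ _).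
rewrite /c raddf_sum /=.
have dlt : ((size p).-1 < size p)%N by rewrite prednK.
rewrite (bigD1 (Ordinal dlt)) //= big1 => [|j].
  rewrite linearZ /= pihomogX /= mdegMn mdeg1 mul1n eqxx addr0.
  by rewrite -/(lead_coef p) (monicP pm) mcoeff1 eqxx scale1r mpolyXn.
rewrite -val_eqE /= => jd.
by rewrite linearZ /= pihomogX /= mdegMn mdeg1 mul1n (negbTE jd) scaler0.
Qed.

Lemma B0_bounded : noether_normalization I [tuple xpen K n; xlast K n] ->
  exists B, forall v, B0 I v -> (mdeg v <= B)%N.
Proof.
move=> hA; have [LI _] := ideal_sum_homog 2 I_homog; have [_ _ LM] := LI.
pose d i := proj1_sig (constructive_indefinite_description _ (variable_power i hA)).
have dP i : ideal_sum I (@tail_ideal K n.+2 2) ('X_i ^+ d i).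
  exact: proj2_sig (constructive_indefinite_description _ (variable_power i hA)).
exists (\sum_i d i)%N => v /B0E Bv; rewrite mdegE; apply: leq_sum => i _.
rewrite leqNgt; apply/negP => /ltnW dv; apply: Bv; apply: ideal_initial => //.
have -> : v = (v - U_(i) *+ d i + U_(i) *+ d i)%MM.
  rewrite submK //; apply/mnm_lepP => j; rewrite mulmnE mnm1E.
  by case: eqP => [<-|_]; rewrite ?mul1n ?mul0n.
by rewrite mpolyXD -mpolyXn; apply: LM.
Qed.

Lemma regularity_candidates_max : ~ I 1 ->
  noether_normalization I [tuple xpen K n; xlast K n] ->
  exists r, is_max (regularity_candidates I) r.
Proof.
move=> I1 hA; have [B hB] := B0_bounded hA.
(* This finite list contains B0, hence B1; each monomial has at most one delta, so the deltas over
   it are bounded. *)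
pose t : seq 'X_{1..n.+2} := [seq (val m) | m : 'X_{1..n.+2 < B.+1}].
have [|B' hB'] := @bounded_on _ t (fun u d => is_delta I u d).
  move=> u; case: (classic (exists d, is_delta I u d)) => [[d [hd hmin]]|h]; last first.
    by exists 0%N => k hk; case: h; exists k.
  by exists d => k [hk kmin]; apply: kmin.
apply: (@is_max_exists _ (B + B')%N) => [|k [[v Bv ->]|[u [d [Bu hd ->]]]]].
(* The set of candidates is nonempty: the monomial 1 is in B0 because [I] is proper. *)
- exists 0%N; left; exists 0%MM; last by rewrite mdeg0.
  have k0 : tail_free 2 (0%MM : 'X_{1..n.+2}) by apply/tail_freeP => i _; rewrite mnm0E.
  apply/B0E => /(initial_ideal_sum_tail I_homog k0)/(homog_initial_ideal I_homog).
  move=> [f [If _ [+ _]]]; rewrite mcoeff_msupp.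
  by rewrite (homog_ideal_constant I_homog I1) ?eqxx.
- by have := hB v Bv; lia.
have [B0u _] := Bu; have uB := hB u B0u.
suff /hB'/(_ hd) : u \in t by lia.
have uB1 : (mdeg u < B.+1)%N by [].
by apply/mapP; exists (BMultinom uB1); rewrite ?mem_enum.
Qed.

End MonomialInvariants.

Theorem corollary2 (K : fieldType) (n : nat) (I : {mpoly K[n.+2]} -> Prop)
  (hK : infinite_type K)
  (hI : is_homog_ideal I)
  (hdim : quotient_dim I 2)
  (hA : noether_normalization I [tuple xpen K n; xlast K n])
  (hx : nonzerodivisor_mod I (xlast K n)) :
  exists r : nat, has_CM_regularity I r /\ is_max (regularity_candidates I) r.
Proof.
have I1 : ~ I 1.
  move=> I1; have [+ _] := hA => /(_ 1); rewrite comp_mpoly1 => /(_ I1)/eqP.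
  by rewrite oner_eq0.
have [r rmax] := regularity_candidates_max hI I1 hA; exists r; split=> //.
have [rcand rle] := rmax.
have [b [s [D [e Fres]]]] := minimal_resolution_exists hI I1.
apply: (regularity_of_quotients hI hx Fres) => [d f rd hf|d f rd hf Lxf|].
(* A nonzero class of degree [d] modulo both variables has a normal form whose leading monomial is
   in B0, so [d] would be a candidate above the maximum. *)
- apply: NNPP => Lf; have [f' [m [_ hf' [mf _] nm]]] := normal_form (ideal_sum_homog 2 hI) hf Lf.
  suff /rle : regularity_candidates I d by lia.
  by left; exists m; [apply/(B0E I) | rewrite hf'].
- apply: NNPP => Lf; suff /rle : regularity_candidates I d by lia.
  by right; apply: delta_of_colon Lf.
case: rcand => [[v /(B0E I) Bv ->]|[u [d [Bu hd ->]]]]; [left | right].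
  exists 'X_[v] => [m|Lv]; first by rewrite msuppX inE => /eqP->.
  by apply: Bv; apply: ideal_initial => //; have [] := ideal_sum_homog 2 hI.
exact: colon_of_delta.
Qed.
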